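(* Let $X$ be a metric space, let $U:\mathcal{P}(\Sigma^{\mathbb{N}})\to X$ be continuous with respect to the weak topology, let $\Lambda:\Sigma^{\mathbb N}\to\mathbb R$ satisfy conditions (C1)–(C3) of the context, and let $C\subseteq X$ be a closed subset of $X$. (1) We have $$\lim_{r\searrow0}\sigma_{\mathrm{ab}}\big(\zeta_C^{U,\Lambda}(\cdot;r)\big)=\underline f^{U,\Lambda}(C).$$ (2) We have $$\lim_{r\searrow0}\sigma_{\mathrm{ab}}\big(\zeta_C^{U,\Lambda}(\cdot;r)\big)=\sup_{\mu\in\mathcal{P}_S(\Sigma^{\mathbb{N}}),\ U\mu\in C}-\frac{h(\mu)}{\int\Lambda\,d\mu}.$$
   Context: Fix a positive integer $N$. $\Sigma^n=\{1,\ldots,N\}^n$; $\Sigma^*=\bigcup_{n\ge1}\Sigma^n$ (finite strings); $\Sigma^{\mathbb N}=\{1,\ldots,N\}^{\mathbb N}$ (infinite strings, product topology). $|\mathbf{i}|$ is the length of $\mathbf{i}\in\Sigma^*$; $\mathbf{i}|n=i_1\ldots i_n$ for $\mathbf{i}\in\Sigma^{\mathbb N}$; $[\mathbf{i}]=\{\mathbf{j}\in\Sigma^{\mathbb N}:\mathbf{j}|n=\mathbf{i}\}$ for $\mathbf{i}\in\Sigma^n$. $S:\Sigma^{\mathbb N}\to\Sigma^{\mathbb N}$ is the shift. $\mathcal P(\Sigma^{\mathbb N})$ is the set of Borel probability measures on $\Sigma^{\mathbb N}$ with the weak topology, $\mathcal P_S(\Sigma^{\mathbb N})$ the subset of shift-invariant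 ones, and $h(\mu)$ the entropy of $\mu\in\mathcal P_S(\Sigma^{\mathbb N})$. Conditions on $\Lambda$: (C1) $\Lambda$ is continuous; (C2) there are constants $-\infty<c_{\min}\le c_{\max}<0$ with $c_{\min}\le\Lambda\le c_{\max}$; (C3) there is a constant $c\ge1$ such that for all positive integers $n$ and all $\mathbf{i},\mathbf{j}\in\Sigma^{\mathbb N}$ with $\mathbf{i}|n=\mathbf{j}|n$, $\frac1c\le\frac{\exp\sum_{k=0}^{n-1}\Lambda(S^k\mathbf{i})}{\exp\sum_{k=0}^{n-1}\Lambda(S^k\mathbf{j})}\le c$. For $\mathbf{i}\in\Sigma^n$, $s_{\mathbf{i}}=\sup_{\mathbf{k}\in[\mathbf{i}]}\exp\sum_{k=0}^{n-1}\Lambda(S^k\mathbf{k})$ (so the empty string has value $1$). For $\mathbf{i}\in\Sigma^{\mathbb N}$, $L_n\mathbf{i}=\frac1n\sum_{k=0}^{n-1}\delta_{S^k\mathbf{i}}\in\mathcal P(\Sigma^{\mathbb N})$, and $UL_n[\mathbf{i}]=\{U(L_n\mathbf{k}):\mathbf{k}\in[\mathbf{i}]\}$. For $C\subseteq X$, $r>0$, $B(C,r)=\{x\in X:\operatorname{dist}(x,C)\le r\}$. Zeta-functions: $\zeta_C^{U,\Lambda}(s)=\sum_{\mathbf{i}\in\Sigma^*,\,UL_{|\mathbf{i}|}[\mathbf{i}]\subseteq C}s_{\mathbf{i}}^s$ and $\zeta_C^{U,\Lambda}(s;r)=\zeta_{B(C,r)}^{U,\Lambda}(s)$, for those complex $s$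 for which the series converges absolutely. Abscissa of convergence of $\zeta(s)=\sum_{\mathbf i}a_{\mathbf i}^s$ (with $a_{\mathbf i}>0$): $\sigma_{\mathrm{ab}}(\zeta)=\inf\{t\in\mathbb R:\sum_{\mathbf{i}}a_{\mathbf{i}}^t\text{ converges absolutely}\}$. Lower coarse multifractal spectrum: for $\mathbf{i}=i_1\ldots i_n\in\Sigma^*$ let $\widehat{\mathbf{i}}=i_1\ldots i_{n-1}$; for $\delta>0$ write $s_{\mathbf{i}}\approx\delta$ iff $s_{\mathbf{i}}\le\delta<s_{\widehat{\mathbf{i}}}$. Let $\Pi_\delta^{U,\Lambda}(C,r)=\{\mathbf{i}\in\Sigma^*:s_{\mathbf{i}}\approx\delta,\ UL_{|\mathbf{i}|}[\mathbf{i}]\subseteq B(C,r)\}$, $N_\delta^{U,\Lambda}(C,r)=|\Pi_\delta^{U,\Lambda}(C,r)|$, $\underline f^{U,\Lambda}(C,r)=\liminf_{\delta\searrow0}\frac{\log N_\delta^{U,\Lambda}(C,r)}{-\log\delta}$ and $\underline f^{U,\Lambda}(C)=\lim_{r\searrow0}\underline f^{U,\Lambda}(C,r)$. Conventions: $\log0=-\infty$, $\sup\varnothing=-\infty$. *)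

(* Defs.v *)
From HB Require Import structures.
From mathcomp Require Import all_boot all_order all_algebra.
From mathcomp Require Import all_classical all_reals all_analysis.

Set Implicit Arguments.
Unset Strict Implicit.
Unset Printing Implicit Defensive.

Import Order.TTheory GRing.Theory Num.Theory.
Import numFieldNormedType.Exports.

Local Open Scope classical_set_scope.
Local Open Scope ring_scope.

(* The alphabet has N.+1 >= 1 letters, numbered from 0. *)
HB.instance Definition _ (N : nat) := isPointed.Build 'I_N.+1 ord0.

Definition strings (N : nat) : Type :=
  prod_topology (fun _ : nat => discrete_topology 'I_N.+1).

HB.instance Definition _ N := Pointed.on (strings N).
HB.instance Definition _ N := Topological.on (strings N).

Definition borel_display (N : nat) : measure_display :=
  sigma_display (@open (strings N)).

HB.instance Definition _ N := @isMeasurable.Build (borel_display N) (strings N)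
  <<s @open (strings N) >> (@sigma_algebra0 _ setT _)
  (@sigma_algebraC _ _) (@sigma_algebra_bigcup _ setT _).

Definition string_shift N (i : strings N) : strings N := fun k => i k.+1.

Definition string_prefix N (n : nat) (i : strings N) : seq 'I_N.+1 := mkseq i n.

Definition cylinder N (i : seq 'I_N.+1) : set (strings N) :=
  [set j | string_prefix (size i) j = i].

(* A member of [probability] is a function on all sets, constrained only on
   the measurable ones. Measures that agree on Borel sets have the same
   integrals, so they have the same neighbourhoods in the topology below, and
   a continuous map into a metric space identifies them. *)

(* Boundedness of the test functions is automatic, as [strings N] is compact. *)
Definition integrals (R : realType) N (mu : probability (strings N) R) :
  prod_topology (fun _ : continuousType (strings N) R => R) :=
  fun f => \int[mu]_x f x.

HB.instance Definition _ (R : realType) N :=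
  Topological.copy (probability (strings N) R)
    (initial_topology (@integrals R N)).

Section invariant.
Context (R : realType) (N : nat).

Definition shift_invariant (mu : probability (strings N) R) : Prop :=
  forall A, measurable A -> mu (@string_shift N @^-1` A) = mu A.

(* For n > 0 the sum of Dirac masses has total mass n, hence this is
   1/n * \sum_(k < n) \d_(S^k i): see [empiricalE]. For n = 0 the sum cannot be
   normalized and the value is the arbitrary measure \d_i. *)
Definition empirical (n : nat) (i : strings N) : probability (strings N) R :=
  mnormalize (msum (fun k => \d_(iter k (@string_shift N) i)) n) \d_i.

Lemma empiricalE (n : nat) (i : strings N) (A : set (strings N)) : (0 < n)%N ->
  empirical n i A =
  ((n%:R^-1)%:E * \sum_(k < n) \d_(iter k (@string_shift N) i) A)%E.
Proof.
move=> n0.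
have nE (m : {measure set (strings N) -> \bar R}) P :
    m setT = n%:R%:E -> mnormalize m P A = ((n%:R^-1)%:E * m A)%E.
  by move=> E; rewrite /mnormalize E eqe pnatr_eq0 eqn0Ngt n0 /= muleC.
apply: nE; rewrite /= /msum (eq_bigr (fun=> 1%E)).
  by rewrite sumEFin big_const_ord iter_addr_0.
by move=> k _; exact: diracT.
Qed.

End invariant.

Section entropy.
Context (R : realType) (d : measure_display) (T : measurableType d).
Variables (mu : probability T R) (S : T -> T).

Definition measurable_partition (m : nat) (A : 'I_m -> set T) : Prop :=
  [/\ forall a, measurable (A a), trivIset setT A & \bigcup_a A a = setT].

(* The atoms of the join of A, S^-1 A, ..., S^-(n-1) A. *)
Definition join_atom (m n : nat) (A : 'I_m -> set T) (w : {ffun 'I_n -> 'I_m}) :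
  set T := [set x | forall k : 'I_n, A (w k) (iter k S x)].

(* [ln] is 0 at 0, so null atoms contribute 0. *)
Definition join_entropy (m n : nat) (A : 'I_m -> set T) : R :=
  \sum_(w : {ffun 'I_n -> 'I_m})
    - (fine (mu (join_atom A w)) * ln (fine (mu (join_atom A w)))).

Definition partition_entropy (m : nat) (A : 'I_m -> set T) : \bar R :=
  limn (fun n => (join_entropy n A / n%:R)%:E).

Definition ks_entropy : \bar R :=
  ereal_sup [set h | exists m (A : 'I_m -> set T),
    measurable_partition A /\ h = partition_entropy A].

End entropy.

Section potential.
Context (R : realType) (N : nat) (L : strings N -> R).

Definition birkhoff (n : nat) (i : strings N) : R :=
  \sum_(k < n) L (iter k (@string_shift N) i).

Definition bounded_negative : Prop :=
  exists cmin cmax : R,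
    [/\ cmin <= cmax, cmax < 0 & forall i, cmin <= L i <= cmax].

Definition bounded_distortion : Prop :=
  exists2 c : R, 1 <= c & forall (n : nat) (i j : strings N), (0 < n)%N ->
    string_prefix n i = string_prefix n j ->
    c^-1 <= expR (birkhoff n i) / expR (birkhoff n j) <= c.

Definition s_ (i : seq 'I_N.+1) : R :=
  sup [set expR (birkhoff (size i) k) | k in cylinder i].

End potential.

(* The series \sum_(i in D) a i ^ t, with a > 0. *)
Definition abscissa (R : realType) (I : choiceType) (D : set I) (a : I -> R) :
  \bar R :=
  ereal_inf [set t%:E | t in [set t : R | summable D (fun i => (a i `^ t)%:E)]].

(* The closed neighbourhood; dist(x, C) = +oo when C is empty. *)
Definition cball (R : realType) (X : metricType R) (C : set X) (r : R) : set X :=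
  [set x | (ereal_inf [set (mdist x y)%:E | y in C] <= r%:E)%E].

Section multifractal.
Context (R : realType) (N : nat) (X : metricType R).
Variables (U : probability (strings N) R -> X) (L : strings N -> R).

Definition UL (i : seq 'I_N.+1) : set X :=
  [set U (empirical R (size i) k) | k in cylinder i].

Definition zeta_strings (C : set X) : set (seq 'I_N.+1) :=
  [set i | i <> [::] /\ UL i `<=` C].

(* The abscissa of convergence of \zeta_C(s) = \sum_(i in zeta_strings C) s_i^s *)
Definition zeta_abscissa (C : set X) : \bar R :=
  abscissa (zeta_strings C) (s_ L).

(* For i = i_1 ... i_n, [take (size i).-1 i] is i_1 ... i_(n-1). *)
Definition s_approx (i : seq 'I_N.+1) (delta : R) : Prop :=
  s_ L i <= delta < s_ L (take (size i).-1 i).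

Definition coarse_strings (C : set X) (r delta : R) : set (seq 'I_N.+1) :=
  [set i | [/\ i <> [::], s_approx i delta & UL i `<=` cball C r]].

(* [lne] is the logarithm on the extended reals, with lne 0 = -oo. *)
Definition coarse_spectrum_at (C : set X) (r : R) : \bar R :=
  limf_einf (fun delta : R =>
    lne (counting (coarse_strings C r delta)) / (- ln delta)%:E)%E 0^'+.

Definition coarse_spectrum (C : set X) : \bar R :=
  lim (coarse_spectrum_at C r @[r --> 0^'+]).

End multifractal.

(* Main.v *)
From HB Require Import structures.
Require Import Defs.
From mathcomp Require Import all_boot all_order all_algebra.
From mathcomp Require Import all_classical all_reals all_analysis.
From mathcomp Require Import measurable_realfun ring lra.
Import Order.TTheory GRing.Theory Num.Theory.
Import numFieldNormedType.Exports.
Local Open Scope classical_set_scope.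
Local Open Scope ring_scope.

Set Implicit Arguments.
Unset Strict Implicit.
Unset Printing Implicit Defensive.

(** Write [sigma r] for the abscissa of the zeta-function of the closed
    [r]-neighbourhood of [C], [f r] for the lower coarse spectrum at scale [r],
    and [sup] for the supremum of the ratios of entropy to minus the integral of
    [L], over the invariant measures that [U] sends into [C]. Both limits follow
    from [sup <= f r <= sigma r], for all [r > 0], and [inf_r sigma r <= sup].

    [f r <= sigma r] ([coarse_spectrum_at_le_zeta_abscissa]). If the series
    converges at [t], each of the words with [s] close to [delta] contributes about
    [delta `^ t] to it, so there are at most a constant times [delta `^ (- t)] of
    them.

    [inf_r sigma r <= sup] ([exists_invariant_measure]). If all the series diverge
    at [t], choose an ultrafilter on words whose sets all carry divergent series
    and along which the lengths tend to infinity. The empirical measures of words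
    converge along it to an invariant measure [mu] with [U mu] in [C]. Each word of
    length [n] whose empirical measure is close to [mu] has probability about
    [expR (- n * H)] for the Markov chain of order [l] with the transition
    probabilities of [mu], where [H] is the conditional entropy of a letter given
    [l] letters. If [H + t * \int[mu]_x L x] were negative, the terms of the series
    would be exponentially smaller than these probabilities, and the series would
    converge. Let [l] grow to get the same inequality for the entropy of [mu].

    [sup <= f r] ([le_coarse_spectrum_at]). For an invariant measure [mu],
    concatenate blocks of a fixed large length drawn independently from [mu]. By
    the law of large numbers ([typical_sequences]) this gives exponentially many
    words whose empirical measures are close to [mu] ([exists_block_words]), at
    nearly the entropy rate of [mu]. Prolonging each of them by few letters until
    its contraction ratio drops to [delta] gives words that are counted by the
    spectrum.

    The entropy of [mu], a supremum over all partitions, enters these estimates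
    through the entropy of words: [ks_entropyE] identifies it with the rate of
    [block_entropy]. *)

(** * Strings and cylinders *)

Section strings_topology.
Context (N : nat).
Implicit Types (x y : strings N) (w : seq 'I_N.+1) (n k : nat).

Lemma size_prefix n x : size (string_prefix n x) = n.
Proof. exact: size_mkseq. Qed.

Lemma nth_prefix n x k : (k < n)%N -> nth ord0 (string_prefix n x) k = x k.
Proof. by move=> kn; rewrite nth_mkseq. Qed.

Lemma prefix_eqP n x y :
  string_prefix n x = string_prefix n y <-> forall k, (k < n)%N -> x k = y k.
Proof.
split=> [xy k kn|xy]; first by rewrite -(nth_prefix x kn) xy nth_prefix.
apply: (@eq_from_nth _ ord0); rewrite !size_prefix// => k kn.
by rewrite !nth_prefix// xy.
Qed.

Lemma take_prefix m n x : (m <= n)%N ->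
  take m (string_prefix n x) = string_prefix m x.
Proof.
move=> mn; apply: (@eq_from_nth _ ord0).
  by rewrite size_takel !size_prefix.
move=> k; rewrite size_takel ?size_prefix// => km.
by rewrite nth_take// !nth_prefix// (leq_trans km).
Qed.

Lemma prefix_leq m n x y : (m <= n)%N ->
  string_prefix n x = string_prefix n y -> string_prefix m x = string_prefix m y.
Proof. by move=> mn xy; rewrite -(take_prefix x mn) xy take_prefix. Qed.

Lemma cylinder_prefix n x y :
  cylinder (string_prefix n x) y <-> string_prefix n y = string_prefix n x.
Proof. by rewrite /cylinder /= size_prefix. Qed.

Definition pad w : strings N := fun k => nth ord0 w k.

Lemma prefix_pad w : string_prefix (size w) (pad w) = w.
Proof.
apply: (@eq_from_nth _ ord0); rewrite ?size_prefix// => k kw.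
by rewrite nth_prefix.
Qed.

Lemma cylinder_pad w : cylinder w (pad w).
Proof. exact: prefix_pad. Qed.

Lemma iter_shiftE k x j : iter k (@string_shift N) x j = x (k + j)%N.
Proof. by elim: k j => //= k IH j; rewrite /string_shift IH addnS. Qed.

Lemma prefix_iter_shift k n x :
  string_prefix n (iter k (@string_shift N) x) =
  drop k (string_prefix (k + n) x).
Proof.
apply: (@eq_from_nth _ ord0); first by rewrite size_drop !size_prefix addKn.
move=> j; rewrite size_prefix => jn.
by rewrite nth_prefix// nth_drop nth_prefix ?ltn_add2l// iter_shiftE.
Qed.

(** The letters carry the discrete topology, so the cylinders around [x] form a
    basis of its neighbourhoods. *)
Lemma nbhs_cylinder x (B : set (strings N)) :
  nbhs x B -> exists n, cylinder (string_prefix n x) `<=` B.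
Proof.
move=> Bx; apply: contrapT => /forallNP nB.
pose F := filter_from setT (fun n => cylinder (string_prefix n x)).
have FF : Filter F.
  apply: filter_from_filter; first by exists 0%N.
  move=> m n _ _; exists (maxn m n) => // y /cylinder_prefix xy.
  by split; apply/cylinder_prefix; apply: prefix_leq xy;
    rewrite ?leq_maxl ?leq_maxr.
have : F --> x.
  apply/cvg_sup => k V [_ [[W oW <-] Wx WV]].
  exists k.+1 => // y /cylinder_prefix/prefix_eqP/(_ k (ltnSn k)) yx.
  by apply: WV; rewrite /= yx.
move=> /(_ _ Bx)[n _ nBx]; exact: nB nBx.
Qed.

Lemma nbhs_prefix n x : nbhs x [set y | string_prefix n y = string_prefix n x].
Proof.
have H (k : 'I_n) : nbhs x [set y : strings N | y k = x k].
  have xk : nbhs (x k : discrete_topology 'I_N.+1) [set x k].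
    by apply: open_nbhs_nbhs; split => //; exact: discrete_open.
  exact: (@proj_continuous nat (fun=> discrete_topology 'I_N.+1) k x _ xk).
apply: filterS (@filter_forall _ _ _ _ (nbhs_filter x) H) => y yx.
by apply/prefix_eqP => k kn; exact: (yx (Ordinal kn)).
Qed.

Lemma open_cylinder w : open (cylinder w).
Proof.
rewrite openE => x /= xw; apply: filterS (nbhs_prefix (size w) x) => y /= yx.
by rewrite /cylinder /= yx.
Qed.

Lemma open_bigcup_cylinder (B : set (strings N)) : open B ->
  B = \bigcup_(w in [set w | cylinder w `<=` B]) cylinder w.
Proof.
move=> oB; apply/seteqP; split=> [x Bx|x [w /= wB wx]]; last exact: wB.
have /nbhs_cylinder[n nB] : nbhs x B by apply: open_nbhs_nbhs.
by exists (string_prefix n x) => //; apply/cylinder_prefix.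
Qed.

Lemma compact_strings : compact [set: strings N].
Proof.
rewrite (_ : setT = [set f : forall i : nat, discrete_topology 'I_N.+1 |
   forall i, [set: discrete_topology 'I_N.+1] (f i)]).
  apply: (@tychonoff nat (fun=> discrete_topology 'I_N.+1) (fun=> setT)) => _.
  apply: (@finite_compact (discrete_topology 'I_N.+1)).
  by apply: (@finite_finset 'I_N.+1).
by apply/seteqP.
Qed.

Lemma continuous_shift : continuous (@string_shift N).
Proof.
move=> x B /nbhs_cylinder[n nB]; apply: filterS (nbhs_prefix n.+1 x) => y.
move=> /prefix_eqP xy; apply: nB; apply/cylinder_prefix/prefix_eqP => k kn.
exact: xy.
Qed.

(** Compactness of the space of strings makes continuous functions uniformly
    close to functions of finitely many letters. *)
Lemma uniform_prefix (R : realType) (f : strings N -> R) (e : R) :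
  continuous f -> 0 < e -> exists m, forall x y,
    string_prefix m x = string_prefix m y -> `|f x - f y| <= e.
Proof.
move=> cf e0.
have /compact_near_coveringP := compact_strings.
move=> /(_ nat \oo (fun m x => forall y, string_prefix m x = string_prefix m y ->
  `|f x - f y| <= e) _).
have H x : [set: strings N] x -> \forall x' \near x & i \near \oo,
    forall y, string_prefix i x' = string_prefix i y -> `|f x' - f y| <= e.
  move=> _; have /nbhs_cylinder[m mx] : nbhs x [set y | `|f x - f y| < e / 2].
    by move/cvgrPdist_lt: (cf x); apply; rewrite divr_gt0.
  exists ([set y | string_prefix m y = string_prefix m x], [set n | (m <= n)%N]).
    by split; [exact: nbhs_prefix | exists m].
  move=> -[x' n] [/= x'x mn] y x'y.
  have /= h1 := mx _ (proj2 (cylinder_prefix m x x') x'x).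
  have yx : string_prefix m y = string_prefix m x.
    by rewrite -x'x; apply/esym; apply: prefix_leq x'y.
  have /= h2 := mx _ (proj2 (cylinder_prefix m x y) yx).
  rewrite (_ : f x' - f y = (f x - f y) - (f x - f x')); last by ring.
  by rewrite (le_trans (ler_normB _ _))// [leRHS]splitr lerD// ltW.
by move=> /(_ H)[m _ /(_ m (leqnn m))] Hm; exists m => x y xy; apply: Hm.
Qed.

End strings_topology.

(** * Laws of maps with finitely many values *)

Section law.
Context (R : realType) (d : measure_display) (T : measurableType d).
Context (P : probability T R).
Implicit Types (A B : set T).

Lemma fine_probK A : measurable A -> (fine (P A))%:E = P A.
Proof. by move=> mA; rewrite fineK// fin_num_measure. Qed.

Lemma fine_prob_ge0 A : 0 <= fine (P A).
Proof. by rewrite fine_ge0. Qed.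

Lemma le_fine_prob A B : measurable A -> measurable B -> A `<=` B ->
  fine (P A) <= fine (P B).
Proof.
move=> mA mB AB; rewrite -lee_fin !fine_probK//.
by apply: le_measure => //; rewrite inE.
Qed.

Definition finite_measurable (W : finType) (xi : T -> W) :=
  forall w, measurable (xi @^-1` [set w]).

Definition law (W : finType) (xi : T -> W) (w : W) : R :=
  fine (P (xi @^-1` [set w])).

Lemma finite_measurable_preimage (W : finType) (xi : T -> W) (D : set W) :
  finite_measurable xi -> measurable (xi @^-1` D).
Proof.
move=> mxi; rewrite (_ : xi @^-1` D = \bigcup_(w in D) (xi @^-1` [set w])).
  apply: fin_bigcup_measurable => [|w _]; last exact: mxi.
  exact: finite_finset.
apply/seteqP; split=> x /=; first by move=> Dx; exists (xi x).
by move=> [w Dw /= ->].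
Qed.

Lemma finite_measurable_pair (W V : finType) (xi : T -> W) (eta : T -> V) :
  finite_measurable xi -> finite_measurable eta ->
  finite_measurable (fun x => (xi x, eta x)).
Proof.
move=> mxi meta [w v].
rewrite (_ : _ @^-1` _ = xi @^-1` [set w] `&` eta @^-1` [set v]).
  exact: measurableI.
by apply/seteqP; split=> x /= [-> ->].
Qed.

Lemma law_ge0 (W : finType) (xi : T -> W) w : 0 <= law xi w.
Proof. exact: fine_prob_ge0. Qed.

Lemma law_sum (W : finType) (xi : T -> W) (D : pred W) :
  finite_measurable xi ->
  \sum_(w | D w) law xi w = fine (P (xi @^-1` [set w | D w])).
Proof.
move=> mxi.
rewrite (_ : xi @^-1` _ = \bigcup_(w in [set w | D w]) (xi @^-1` [set w])).
  rewrite measure_fin_bigcup//.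
  - rewrite -(@bigfs _ _ _ _ (index_enum W)) ?index_enum_uniq//; last first.
      by move=> w _; rewrite mem_index_enum.
    by rewrite -sum_fine// => w _; exact: fin_num_measure.
  - exact: finite_finset.
  - by apply/trivIsetP => w v _ _ wv; apply/seteqP; split=> x //= [-> vw];
      rewrite vw eqxx in wv.
apply/seteqP; split=> x /=; first by move=> Dx; exists (xi x).
by move=> [w Dw /= ->].
Qed.

Lemma law_sum1 (W : finType) (xi : T -> W) : finite_measurable xi ->
  \sum_w law xi w = 1.
Proof.
move=> mxi; rewrite (law_sum predT)//.
by rewrite (_ : _ @^-1` _ = setT) ?probability_setT//; apply/seteqP.
Qed.

Lemma law_le1 (W : finType) (xi : T -> W) w : finite_measurable xi ->
  law xi w <= 1.
Proof.
move=> mxi; rewrite -(law_sum1 mxi) (bigD1 w)//= lerDl.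
by apply: sumr_ge0 => *; exact: law_ge0.
Qed.

Lemma law_comp (W V : finType) (f : W -> V) (xi : T -> W) v :
  finite_measurable xi -> law (f \o xi) v = \sum_(w | f w == v) law xi w.
Proof.
move=> mxi; rewrite law_sum// /law; congr (fine (P _)).
by apply/seteqP; split=> x /= /eqP.
Qed.

Lemma sum_law_comp (W V : finType) (f : W -> V) (xi : T -> W) (g : V -> R) :
  finite_measurable xi ->
  \sum_v law (f \o xi) v * g v = \sum_w law xi w * g (f w).
Proof.
move=> mxi; rewrite (partition_big f xpredT)//=; apply: eq_bigr => v _.
by rewrite law_comp// mulr_suml; apply: eq_bigr => w /eqP ->.
Qed.

Lemma law_le_comp (W V : finType) (f : W -> V) (xi : T -> W) w :
  finite_measurable xi -> law xi w <= law (f \o xi) (f w).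
Proof.
move=> mxi; rewrite law_comp// (bigD1 w)//= lerDl.
by apply: sumr_ge0 => *; exact: law_ge0.
Qed.

Lemma law_shift (W : finType) (xi : T -> W) (S : T -> T) k w :
  measurable_fun setT S ->
  (forall A, measurable A -> P (S @^-1` A) = P A) -> finite_measurable xi ->
  law (xi \o iter k S) w = law xi w.
Proof.
move=> mS iS mxi; elim: k => [|k IH]; first by congr (fine (P _)).
rewrite -IH /law; congr fine.
rewrite -[RHS]iS; last first.
  rewrite comp_preimage; elim: k {IH} => [|k IH]; first exact: mxi.
  rewrite (_ : iter k.+1 S = iter k S \o S); last first.
    by apply/funext => x /=; rewrite -iterSr.
  rewrite comp_preimage -[X in measurable X]setTI; exact: mS.
by congr (P _); apply/seteqP; split=> x /=; rewrite -iterSr.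
Qed.

End law.

(** * Shannon entropy of finite laws *)

Section entropy.
Context (R : realType).

Definition entropy (W : finType) (p : W -> R) : R := \sum_w - (p w * ln (p w)).

(** Gibbs' inequality, from [ln x <= x - 1] at [x = q w / p w]. Most of
    the entropy estimates below apply it to a well chosen [q]. *)
Lemma gibbs (W : finType) (p q : W -> R) :
  (forall w, 0 <= p w) -> (forall w, 0 <= q w) ->
  (forall w, 0 < p w -> 0 < q w) -> \sum_w q w <= \sum_w p w ->
  entropy p <= \sum_w - (p w * ln (q w)).
Proof.
move=> p0 q0 pq sqp.
suff : entropy p <= \sum_w - (p w * ln (q w)) + \sum_w (q w - p w).
  by move/le_trans; apply; rewrite gerDl sumrB subr_le0.
rewrite -big_split/=; apply: ler_sum => w _.
have [pw0|pn0] := eqVneq (p w) 0.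
  by rewrite pw0 !mul0r oppr0 add0r addr0.
have pw : 0 < p w by rewrite lt_neqAle eq_sym pn0 p0.
have qw := pq _ pw.
have : ln (q w / p w) <= q w / p w - 1.
  have qp : 0 < q w / p w by rewrite divr_gt0.
  rewrite -[X in ln X](subrK 1) addrC; apply: le_ln1Dx.
  by rewrite ltrBrDr addNr.
rewrite ln_div// => /(ler_wpM2l (p0 w)).
rewrite !mulrBr mulr1 mulrCA divff// mulr1; lra.
Qed.

Lemma entropy_ge0 (W : finType) (p : W -> R) :
  (forall w, 0 <= p w <= 1) -> 0 <= entropy p.
Proof.
move=> p01; apply: sumr_ge0 => w _; have /andP[p0 p1] := p01 w.
by rewrite -mulrN mulr_ge0// oppr_ge0 ln_le0.
Qed.

Context (d : measure_display) (T : measurableType d) (P : probability T R).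

(** A value of [f \o xi] is at least as likely as each value of [xi] over it. *)
Lemma entropy_law_comp (W V : finType) (f : W -> V) (xi : T -> W) :
  finite_measurable xi -> entropy (law P (f \o xi)) <= entropy (law P xi).
Proof.
move=> mxi; rewrite /entropy.
under eq_bigr do rewrite -mulrN.
rewrite sum_law_comp//; apply: ler_sum => w _; rewrite mulrN lerN2.
have := law_ge0 P xi w; rewrite le_eqVlt => /predU1P[<-|pw].
  by rewrite !mul0r.
have le := law_le_comp P f w mxi.
by rewrite ler_pM2l// ler_ln ?posrE// (lt_le_trans pw).
Qed.

End entropy.

Section law_split.
Context (R : realType) (d : measure_display) (T : measurableType d).
Context (P : probability T R).

Lemma prob_split (W : finType) (xi : T -> W) (B : set T) :
  finite_measurable xi -> measurable B ->
  fine (P B) = \sum_w fine (P (B `&` xi @^-1` [set w])).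
Proof.
move=> mxi mB.
have {1}-> : B = \bigcup_(w in [set w | xpredT w]) (B `&` xi @^-1` [set w]).
  apply/seteqP; split=> x /=; first by move=> Bx; exists (xi x).
  by move=> [w _ []].
have mI w : measurable (B `&` xi @^-1` [set w]) by exact: measurableI.
rewrite measure_fin_bigcup//.
- rewrite -(@bigfs _ _ _ _ (index_enum W)) ?index_enum_uniq//; last first.
    by move=> w _; rewrite mem_index_enum.
  by rewrite -sum_fine// => w _; exact: fin_num_measure.
- exact: finite_finset.
- by apply/trivIsetP => w v _ _ wv; apply/seteqP; split=> x //= [[_ ->] [_ vw]];
    rewrite vw eqxx in wv.
Qed.

End law_split.

(** * Entropy of stationary finite-valued processes *)

Section fekete.
Context (R : realType) (u : nat -> R).

Definition rate : R := inf [set u n.+1 / n.+1%:R | n in [set: nat]].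

Hypothesis u0 : forall n, 0 <= u n.
Hypothesis subadd : forall m n, u (m + n)%N <= u m + u n.

Let lb : has_inf [set u n.+1 / n.+1%:R | n in [set: nat]].
Proof.
split; first by exists (u 1%N / 1), 0%N.
by exists 0 => _ [n _ <-]; rewrite divr_ge0.
Qed.

Lemma rate_le n : (0 < n)%N -> rate <= u n / n%:R.
Proof. by case: n => // n _; apply: ge_inf; [exact: lb.2|exists n]. Qed.

Lemma le_rate (c : R) : (forall n, (0 < n)%N -> c * n%:R <= u n) -> c <= rate.
Proof.
move=> cu; apply: lb_le_inf; first exact: lb.1.
by move=> _ [n _ <-]; rewrite ler_pdivlMr ?ltr0n// cu.
Qed.

(** Fekete's lemma: cut [n] into blocks of a length [m.+1] that almost attains
    the infimum; the remainder costs at most the constant [K]. *)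
Lemma fekete : u n / n%:R @[n --> \oo] --> rate.
Proof.
apply/cvgrPdist_le => e e0.
have e2 : 0 < e / 2 by rewrite divr_gt0.
have [_ [m _ <-] ume] := inf_adherent e2 lb.
pose K := \sum_(r < m.+1) u r.
have uK q r : (r < m.+1)%N -> u (q * m.+1 + r)%N <= q%:R * u m.+1 + K.
  move=> rm; elim: q => [|q IH].
    rewrite mul0n add0n mul0r add0r /K (bigD1 (Ordinal rm))//= lerDl.
    exact: sumr_ge0.
  rewrite mulSn -addnA; apply: le_trans (subadd _ _) _.
  by rewrite -natr1 mulrDl mul1r [X in X + K]addrC -addrA lerD2l.
have K0 : 0 <= K by exact: sumr_ge0.
near=> n.
have n0 : (0 < n)%N by near: n; exists 1%N.
rewrite distrC ger0_norm ?subr_ge0 ?rate_le//.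
rewrite lerBlDr ler_pdivrMr ?ltr0n//.
have un : u n <= (n %/ m.+1)%:R * u m.+1 + K.
  by rewrite {1}(divn_eq n m.+1); apply: uK; rewrite ltn_mod.
apply: le_trans un _.
have h1 : (n %/ m.+1)%:R * u m.+1 <= (rate + e / 2) * n%:R.
  have le1 : (n %/ m.+1)%:R <= n%:R / m.+1%:R :> R.
    by rewrite ler_pdivlMr ?ltr0n// -natrM ler_nat leq_trunc_div.
  apply: le_trans (ler_wpM2r (u0 _) le1) _.
  by rewrite mulrAC -mulrA mulrC ler_wpM2r// ltW// mulrC.
have h2 : K <= e / 2 * n%:R.
  rewrite mulrC -ler_pdivrMr//; near: n; exact: nbhs_infty_ger.
by rewrite (le_trans (lerD h1 h2))// -mulrDl; apply: ler_wpM2r => //; lra.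
Unshelve. all: by end_near. Qed.

End fekete.

Lemma ln_prod (R : realType) (I : Type) (r : seq I) (F : I -> R) :
  (forall i, 0 < F i) -> ln (\prod_(i <- r) F i) = \sum_(i <- r) ln (F i).
Proof.
move=> F0; suff [] : 0 < \prod_(i <- r) F i /\
  ln (\prod_(i <- r) F i) = \sum_(i <- r) ln (F i) by [].
elim/big_ind2 : _ => [|x1 x2 y1 y2 [x0 <-] [y0 <-]|//].
  by rewrite ln1.
by rewrite mulr_gt0// lnM.
Qed.

Section process.
Context (R : realType) (d : measure_display) (T : measurableType d).
Context (P : probability T R) (S : T -> T).
Hypothesis mS : measurable_fun setT S.
Hypothesis PS : forall A, measurable A -> P (S @^-1` A) = P A.

Definition orbit_word (W : finType) (xi : T -> W) (n : nat) (x : T) :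
  {ffun 'I_n -> W} := [ffun k : 'I_n => xi (iter k S x)].

Definition orbit_entropy (W : finType) (xi : T -> W) (n : nat) : R :=
  entropy (law P (orbit_word xi n)).

Lemma finite_measurable_iter (W : finType) (xi : T -> W) k :
  finite_measurable xi -> finite_measurable (xi \o iter k S).
Proof.
move=> mxi; elim: k => [|k IH] w; first exact: mxi.
rewrite (_ : xi \o iter k.+1 S = (xi \o iter k S) \o S); last first.
  by apply/funext => x /=; rewrite -iterSr.
by rewrite comp_preimage -[X in measurable X]setTI; exact: mS.
Qed.

Lemma finite_measurable_ffun (n : nat) (W : finType) (xi : 'I_n -> T -> W) :
  (forall k, finite_measurable (xi k)) ->
  finite_measurable (fun x => [ffun k => xi k x]).
Proof.
move=> mxi w.
rewrite (_ : _ @^-1` _ = \bigcap_(k in [set: 'I_n]) xi k @^-1` [set w k]).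
  apply: fin_bigcap_measurable => [|k _]; last exact: mxi.
  exact: finite_finset.
apply/seteqP; split=> x /=; first by move=> <- k _ /=; rewrite ffunE.
by move=> H; apply/ffunP => k; rewrite ffunE; exact: H.
Qed.

Lemma finite_measurable_orbit_word (W : finType) (xi : T -> W) n :
  finite_measurable xi -> finite_measurable (orbit_word xi n).
Proof.
by move=> mxi; apply: finite_measurable_ffun => k; exact: finite_measurable_iter.
Qed.

Lemma orbit_entropy_ge0 (W : finType) (xi : T -> W) n :
  finite_measurable xi -> 0 <= orbit_entropy xi n.
Proof.
move=> mxi; apply: entropy_ge0 => w; rewrite law_ge0 law_le1//.
exact: finite_measurable_orbit_word.
Qed.

(** Gibbs' inequality against the product of the two marginals. *)
Lemma entropy_pair_le (W V : finType) (xi : T -> W) (eta : T -> V) :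
  finite_measurable xi -> finite_measurable eta ->
  entropy (law P (fun x => (xi x, eta x))) <=
  entropy (law P xi) + entropy (law P eta).
Proof.
move=> mxi meta; have mp := finite_measurable_pair mxi meta.
apply: (le_trans (@gibbs _ _ _ (fun wv => law P xi wv.1 * law P eta wv.2) _ _ _ _)).
- by move=> *; exact: law_ge0.
- by move=> *; rewrite mulr_ge0// law_ge0.
- move=> wv p0.
  have h1 := law_le_comp P fst wv mp; have h2 := law_le_comp P snd wv mp.
  by rewrite mulr_gt0// (lt_le_trans p0).
- rewrite (law_sum1 P mp) -(pair_big xpredT xpredT (fun w v => law P xi w * law P eta v))/=.
  under eq_bigr do rewrite -mulr_sumr (law_sum1 P meta) mulr1.
  by rewrite law_sum1.
rewrite /entropy.
under [X in _ <= X + _]eq_bigr do rewrite -mulrN.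
under [X in _ <= _ + X]eq_bigr do rewrite -mulrN.
have -> : \sum_w law P xi w * - ln (law P xi w) =
    \sum_wv law P (fun x => (xi x, eta x)) wv * - ln (law P xi wv.1).
  exact: (sum_law_comp P fst (fun w => - ln (law P xi w)) mp).
have -> : \sum_w law P eta w * - ln (law P eta w) =
    \sum_wv law P (fun x => (xi x, eta x)) wv * - ln (law P eta wv.2).
  exact: (sum_law_comp P snd (fun w => - ln (law P eta w)) mp).
rewrite -big_split/=; apply: ler_sum => wv _.
have := law_ge0 P (fun x => (xi x, eta x)) wv; rewrite le_eqVlt => /predU1P[<-|p0].
  by rewrite !mul0r oppr0 addr0.
have h1 := law_le_comp P fst wv mp; have h2 := law_le_comp P snd wv mp.
rewrite lnM ?posrE ?(lt_le_trans p0 h1) ?(lt_le_trans p0 h2)//.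
by rewrite mulrDr opprD !mulrN.
Qed.

(** The word of length [m + n] is the word of length [m] followed by the word of
    length [n] of the point [iter m S x], whose law is the same by invariance. *)
Lemma orbit_entropy_subadd (W : finType) (xi : T -> W) m n :
  finite_measurable xi ->
  orbit_entropy xi (m + n) <= orbit_entropy xi m + orbit_entropy xi n.
Proof.
move=> mxi.
have mm : finite_measurable (orbit_word xi m) by exact: finite_measurable_orbit_word.
have mn : finite_measurable (orbit_word xi n) by exact: finite_measurable_orbit_word.
have mnm := finite_measurable_iter m mn.
pose f (uv : {ffun 'I_m -> W} * {ffun 'I_n -> W}) : {ffun 'I_(m + n) -> W} :=
  [ffun k => match fintype.split k with inl i => uv.1 i | inr j => uv.2 j end].
rewrite [X in X <= _](_ : _ =
  entropy (law P (f \o fun x => (orbit_word xi m x, orbit_word xi n (iter m S x)))));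
  last first.
  congr (entropy (law P _)); apply/funext => x; apply/ffunP => k; rewrite !ffunE /=.
  case: splitP => j kj; rewrite !ffunE kj//.
  by rewrite -iterD addnC.
apply: (le_trans (entropy_law_comp _ _ (finite_measurable_pair mm mnm))).
apply: (le_trans (entropy_pair_le mm mnm)).
rewrite lerD2l /orbit_entropy /entropy.
by under eq_bigr do rewrite law_shift//.
Qed.

(** Knowing the word of [eta], guess the letters of the word of [xi]
    independently with the kernel [q], and apply Gibbs' inequality to this
    guess. By invariance each letter costs the same on average. *)
Lemma orbit_entropy_le_kernel (W V : finType) (xi : T -> W) (eta : T -> V)
    (q : V -> W -> R) n :
  finite_measurable xi -> finite_measurable eta ->
  (forall v w, 0 < q v w) -> (forall v, \sum_w q v w <= 1) ->
  orbit_entropy xi n <= orbit_entropy eta n +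
    n%:R * \sum_wv law P (fun x => (xi x, eta x)) wv * - ln (q wv.2 wv.1).
Proof.
move=> mxi meta q0 q1.
have mx : finite_measurable (orbit_word xi n) by exact: finite_measurable_orbit_word.
have me : finite_measurable (orbit_word eta n) by exact: finite_measurable_orbit_word.
have mp := finite_measurable_pair mx me.
pose zeta x := (orbit_word xi n x, orbit_word eta n x).
pose Q (z : {ffun 'I_n -> W} * {ffun 'I_n -> V}) : R :=
  law P (orbit_word eta n) z.2 * \prod_k q (z.2 k) (z.1 k).
have pq z : 0 < law P zeta z -> 0 < law P (orbit_word eta n) z.2.
  by move=> p0; exact: lt_le_trans (law_le_comp P snd z mp).
apply: (le_trans (entropy_law_comp P (fst : _ * {ffun 'I_n -> V} -> _) mp)).
apply: (le_trans (@gibbs _ _ _ Q _ _ _ _)).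
- by move=> *; exact: law_ge0.
- by move=> z; rewrite mulr_ge0 ?law_ge0// prodr_ge0// => k _; exact: ltW.
- by move=> z /pq z0; rewrite mulr_gt0// prodr_gt0.
- rewrite (law_sum1 P mp) -(pair_big xpredT xpredT (fun (u : {ffun 'I_n -> W})
    (v : {ffun 'I_n -> V}) => law P (orbit_word eta n) v * \prod_k q (v k) (u k)))/= exchange_big/=.
  rewrite -[leRHS](law_sum1 P me); apply: ler_sum => v _.
  rewrite -mulr_sumr ler_piMr ?law_ge0//.
  rewrite -(bigA_distr_bigA (fun k w => q (v k) w))/=.
  by apply: prodr_ile1 => k _; rewrite q1 sumr_ge0// => w _; exact: ltW.
rewrite [X in _ <= X + _](_ : _ =
    \sum_z law P zeta z * - ln (law P (orbit_word eta n) z.2)); last first.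
  rewrite /orbit_entropy /entropy; under eq_bigr do rewrite -mulrN.
  exact: (sum_law_comp P snd (fun v => - ln (law P (orbit_word eta n) v)) mp).
rewrite [X in _ <= _ + X](_ : _ =
    \sum_z law P zeta z * \sum_(k < n) - ln (q (z.2 k) (z.1 k))); last first.
  under [RHS]eq_bigr do rewrite mulr_sumr.
  rewrite exchange_big/= mulr_natl -[n in LHS]card_ord -sumr_const.
  apply: eq_bigr => k _.
  rewrite -(sum_law_comp P (fun z : {ffun 'I_n -> W} * {ffun 'I_n -> V} => (z.1 k, z.2 k))
    (fun wv => - ln (q wv.2 wv.1)) mp).
  apply: eq_bigr => wv _; congr (_ * _).
  rewrite -(law_shift k wv mS PS (finite_measurable_pair mxi meta)).
  by congr (law P _ _); apply/funext => x /=; rewrite !ffunE.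
rewrite -big_split/=; apply: ler_sum => z _.
have := law_ge0 P zeta z; rewrite le_eqVlt => /predU1P[<-|p0].
  by rewrite !mul0r oppr0 addr0.
rewrite /Q lnM ?posrE ?pq ?prodr_gt0// mulrDr opprD mulrN lerD2l.
rewrite -mulrN ler_pM2l//.
by rewrite sumrN lerN2 ln_prod.
Qed.

(** If [xi] is a function of [eta] up to a small error, guessing the value
    that [eta] predicts, with a little probability kept for every other value,
    makes the cost per letter small. *)
Lemma orbit_entropy_le_guess (W : finType) (xi : T -> W) (e : R) :
  finite_measurable xi -> 0 < e ->
  exists2 dl : R, 0 < dl & forall (V : finType) (eta : T -> V) (f : V -> W),
    finite_measurable eta -> fine (P [set x | xi x <> f (eta x)]) <= dl ->
    forall n, orbit_entropy xi n <= orbit_entropy eta n + n%:R * e.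
Proof.
move=> mxi e0; pose M : R := #|W|%:R.
have M1 : 1 <= M by rewrite ler1n; apply/card_gt0P; exists (xi point).
have M0 : 0 < M by exact: lt_le_trans M1.
(* The predicted letter is guessed with weight [b], the remaining weight [kap]
   is shared by all the letters. A right prediction costs at most [- ln b],
   which is [e / 2], a wrong one at most [K]. *)
pose b := expR (- (e / 2)); pose kap := 1 - b.
have b0 : 0 < b by exact: expR_gt0.
have kap0 : 0 < kap by rewrite subr_gt0 -expR0 ltr_expR oppr_lt0 divr_gt0.
have kap1 : kap <= 1 by rewrite gerBl ltW.
have kM0 : 0 < kap / M by rewrite divr_gt0.
pose K := - ln (kap / M).
have K0 : 0 <= K by rewrite oppr_ge0 ln_le0// ler_pdivrMr// mul1r (le_trans kap1).
exists (e / 2 / (K + 1)); first by rewrite divr_gt0 ?divr_gt0// ltr_wpDl.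
move=> V eta f meta Hf n; pose q v w : R := b * (w == f v)%:R + kap / M.
have q0 v w : 0 < q v w by rewrite ltr_wpDl// mulr_ge0// ltW.
have q1 v : \sum_w q v w <= 1.
  rewrite big_split/= -mulr_sumr sumr_const -[X in _ + X]mulr_natr divfK ?gt_eqF//.
  rewrite (bigD1 (f v))//= eqxx big1 => [|w /negbTE->//].
  by rewrite addr0 mulr1 /kap addrC subrK.
apply: (le_trans (orbit_entropy_le_kernel n mxi meta q0 q1)).
rewrite lerD2l ler_wpM2l//.
have mp := finite_measurable_pair mxi meta.
set p := law P _ in mp *.
have p0 wv : 0 <= p wv by exact: law_ge0.
have le1 wv : p wv * - ln (q wv.2 wv.1) <=
    p wv * (e / 2) + (if wv.1 != f wv.2 then p wv else 0) * K.
  case: ifPn => [_|/negPn/eqP E].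
    rewrite -mulrDr ler_wpM2l// (@le_trans _ _ K)//.
      by rewrite lerN2 ler_ln ?posrE// lerDr mulr_ge0// ltW.
    by rewrite lerDr ltW// divr_gt0.
  rewrite mul0r addr0 ler_wpM2l// lerNl -[X in X <= _]expRK ler_ln ?posrE//.
  by rewrite /q E eqxx mulr1 lerDl ltW.
apply: le_trans (ler_sum _ (fun wv _ => le1 wv)) _.
rewrite big_split/= -!mulr_suml law_sum1// mul1r -big_mkcond/=.
rewrite law_sum//= [leRHS]splitr lerD2l.
have -> : (fun x => (xi x, eta x)) @^-1` [set wv | wv.1 != f wv.2] =
    [set x | xi x <> f (eta x)].
  by apply/seteqP; split=> x /= /eqP.
apply: le_trans (ler_wpM2r K0 Hf) _.
by rewrite mulrAC ler_pdivrMr ?ltr_wpDl// ler_wpM2l ?lerDl// divr_ge0// ltW.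
Qed.

End process.

(** * Measures on strings and their cylinders *)

Section string_measures.
Context (R : realType) (N : nat).
Implicit Types (mu : probability (strings N) R) (w : seq 'I_N.+1).

Lemma open_measurable_strings (B : set (strings N)) : open B -> measurable B.
Proof. by move=> oB; apply: sub_sigma_algebra. Qed.

Lemma measurable_cylinder w : measurable (cylinder w).
Proof. by apply: open_measurable_strings; exact: open_cylinder. Qed.

Lemma measurable_shift : measurable_fun setT (@string_shift N).
Proof.
apply: (@measurability _ _ _ _ _ _ (@open (strings N))) => //.
move=> _ [B oB <-]; rewrite setTI; apply: open_measurable_strings.
by apply: open_comp => // x _; exact: continuous_shift.
Qed.

Lemma continuous_measurable_strings (f : strings N -> R) :
  continuous f -> measurable_fun setT f.
Proof.
move=> cf; apply: (measurability _ (RGenOpens.measurableE R)).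
move=> _ [_ [a [b ->]] <-]; rewrite setTI; apply: open_measurable_strings.
by apply: open_comp => [x _|]; [exact: cf|exact: interval_open].
Qed.

Definition cyl mu w : R := fine (mu (cylinder w)).

Lemma cylE mu w : mu (cylinder w) = (cyl mu w)%:E.
Proof. by rewrite fine_probK//; exact: measurable_cylinder. Qed.

Lemma cyl_ge0 mu w : 0 <= cyl mu w.
Proof. exact: fine_prob_ge0. Qed.

Lemma cylinder_nil : cylinder [::] = [set: strings N].
Proof. by apply/seteqP. Qed.

Lemma cyl_nil mu : cyl mu [::] = 1.
Proof. by rewrite /cyl cylinder_nil probability_setT. Qed.

Lemma cylinder_letter (x : strings N) k (w : seq 'I_N.+1) : size w = k.+1 ->
  cylinder w x <-> cylinder (take k w) x /\ x k = nth ord0 w k.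
Proof.
move=> wk; rewrite /cylinder /= wk size_takel ?wk//; split.
  by move=> <-; rewrite take_prefix// nth_prefix.
move=> [xw xk]; apply: (@eq_from_nth _ ord0); rewrite ?size_prefix// => j.
rewrite ltnS leq_eqVlt => /predU1P[->|jk]; first by rewrite nth_prefix.
have := nth_take ord0 jk w; rewrite -xw nth_prefix// => <-.
by rewrite nth_prefix// ltnS ltnW.
Qed.

Lemma cylinder_rcons w a (x : strings N) :
  cylinder (rcons w a) x <-> cylinder w x /\ x (size w) = a.
Proof.
rewrite (@cylinder_letter x (size w)) ?size_rcons//.
by rewrite -cats1 take_size_cat// cats1 nth_rcons ltnn eqxx.
Qed.

Lemma cylinder_cons a w (x : strings N) :
  cylinder (a :: w) x <-> x 0%N = a /\ cylinder w (string_shift x).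
Proof.
rewrite /cylinder /=; have -> : string_prefix (size w).+1 x =
    x 0%N :: string_prefix (size w) (string_shift x).
  by rewrite /string_prefix /mkseq /= -[1%N]add1n iotaDl -map_comp.
by split=> [[-> ->]//|[-> ->]].
Qed.

Lemma finite_measurable_letter k :
  finite_measurable (fun x : strings N => x k).
Proof.
move=> a; apply: open_measurable_strings; apply: open_comp; last first.
  exact: (@discrete_open (discrete_topology 'I_N.+1)).
by move=> x _; exact: (@proj_continuous nat (fun=> discrete_topology 'I_N.+1)).
Qed.

Lemma cyl_rcons mu w : cyl mu w = \sum_a cyl mu (rcons w a).
Proof.
rewrite /cyl (prob_split mu (finite_measurable_letter (size w)))//; last first.
  exact: measurable_cylinder.
apply: eq_bigr => a _; congr (fine (mu _)).
by apply/seteqP; split=> x /cylinder_rcons.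
Qed.

Definition cylinders : set (set (strings N)) :=
  [set C | C = set0 \/ exists w, C = cylinder w].

(** There are countably many cylinders, so open sets are countable unions of
    cylinders. *)
Lemma measurable_cylindersE : @measurable _ (strings N) = <<s cylinders >>.
Proof.
apply/seteqP; split; last first.
  apply: smallest_sub => [|C [->|[w ->]]].
  - exact: sigma_algebra_measurable.
  - exact: measurable0.
  - exact: measurable_cylinder.
apply: smallest_sub; first exact: smallest_sigma_algebra.
move=> B oB; pose F n := if unpickle n is Some w then
  (if `[< cylinder w `<=` B >] then cylinder w else set0) else set0.
have -> : B = \bigcup_n F n.
  rewrite (open_bigcup_cylinder oB); apply/seteqP; split=> [x [w /= wB wx]|x].
    by exists (pickle w) => //; rewrite /F pickleK asboolT.
  move=> [n _]; rewrite /F; case: unpickle => // w.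
  by case: asboolP => // wB wx; exists w.
apply: sigma_algebra_bigcup => n; rewrite /F.
case: unpickle => [w|]; last exact: sigma_algebra0.
case: ifP => _; last exact: sigma_algebra0.
by apply: sub_sigma_algebra; right; exists w.
Qed.

(** Two cylinders are nested or disjoint, so cylinders and the empty set are
    stable under intersection. *)
Lemma eq_cylinders (m1 m2 : probability (strings N) R) :
  (forall w, m1 (cylinder w) = m2 (cylinder w)) ->
  forall A, measurable A -> m1 A = m2 A.
Proof.
move=> m12; apply: (measure_unique cylinders (fun=> setT)) => //.
- exact: measurable_cylindersE.
- move=> A B [->|[u ->]]; first by rewrite set0I; left.
  move=> [->|[v ->]]; first by rewrite setI0; left.
  wlog uv : u v / (size u <= size v)%N.
    by move=> H; case: (leqP (size u) (size v)) => [/H//|/ltnW/H]; rewrite setIC.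
  have [E|E] := eqVneq (take (size u) v) u.
    right; exists v; apply/seteqP; split=> x /= => [[]//|xv]; split=> //.
    by rewrite /cylinder /= -(take_prefix _ uv) xv.
  left; apply/seteqP; split=> x //= -[xu xv].
  by move/eqP: E; apply; rewrite -[in LHS]xv take_prefix.
- by move=> _; right; exists [::]; rewrite cylinder_nil.
- by apply/seteqP; split=> x // _; exists 0%N.
- by move=> A [->|[w ->]]; [rewrite !measure0|exact: m12].
- by move=> _; rewrite (le_lt_trans (probability_le1 m1 measurableT))// ltry.
Qed.

Definition prefix_tuple n (x : strings N) : n.-tuple 'I_N.+1 :=
  Tuple (introT eqP (size_prefix n x)).

Lemma prefix_tuple_cylinder n (t : n.-tuple 'I_N.+1) :
  prefix_tuple n @^-1` [set t] = cylinder t.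
Proof.
apply/seteqP; split=> x /=; rewrite /cylinder /= size_tuple; first by move=> <-.
by move=> xt; apply: val_inj.
Qed.

Lemma finite_measurable_prefix n : finite_measurable (prefix_tuple n).
Proof. by move=> t; rewrite prefix_tuple_cylinder; exact: measurable_cylinder. Qed.

Lemma law_prefix mu n (t : n.-tuple 'I_N.+1) : law mu (prefix_tuple n) t = cyl mu t.
Proof. by rewrite /law prefix_tuple_cylinder. Qed.

Lemma measurable_prefix_set n (D : set (seq 'I_N.+1)) :
  measurable [set x : strings N | D (string_prefix n x)].
Proof.
exact: (finite_measurable_preimage [set t : n.-tuple _ | D t]
  (@finite_measurable_prefix n)).
Qed.

End string_measures.

HB.instance Definition _ N := @isMeasurableFun.Build _ _ (strings N) (strings N)
  (@string_shift N) (@measurable_shift N).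

Section approximation.
Context (R : realType) (N : nat) (mu : probability (strings N) R).
Local Notation A := 'I_N.+1.

Lemma shift_invariant_cyl :
  (forall w, cyl mu w = \sum_a cyl mu (a :: w)) -> shift_invariant mu.
Proof.
move=> H B mB.
apply: (@eq_cylinders R N (distribution mu (@string_shift N)) mu) => // w.
rewrite [RHS]cylE H; change (mu (@string_shift N @^-1` cylinder w) =
  (\sum_a cyl mu (a :: w))%:E).
have mS : measurable (@string_shift N @^-1` cylinder w).
  by rewrite -[X in measurable X]setTI; apply: measurable_shift => //;
    exact: measurable_cylinder.
rewrite -(fine_probK mu mS); congr (_%:E).
rewrite (prob_split mu (finite_measurable_letter 0) mS).
apply: eq_bigr => a _; congr (fine (mu _)).
by apply/seteqP; split=> x; rewrite cylinder_cons => -[].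
Qed.

Definition symdiff (B E : set (strings N)) := (B `\` E) `|` (E `\` B).

Lemma measurable_symdiff B E :
  measurable B -> measurable E -> measurable (symdiff B E).
Proof. by move=> mB mE; apply: measurableU; exact: measurableD. Qed.

Definition approximable (B : set (strings N)) := forall e : R, 0 < e ->
  exists n (D : set (seq A)),
    fine (mu (symdiff B [set x | D (string_prefix n x)])) < e.

Lemma fine_probU (B E : set (strings N)) : measurable B -> measurable E ->
  fine (mu (B `|` E)) <= fine (mu B) + fine (mu E).
Proof.
move=> mB mE; rewrite -lee_fin EFinD !fine_probK//; last exact: measurableU.
exact: measureU2.
Qed.

Lemma approximableC B : approximable B -> approximable (~` B).
Proof.
move=> aB e /aB[n [D BD]]; exists n, (~` D).
rewrite (_ : symdiff _ _ = symdiff B [set x | D (string_prefix n x)])//.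
by apply/seteqP; split=> x /= [[h1 h2]|[h1 h2]];
  [right|left|right|left]; split=> //; apply: contrapT.
Qed.

Lemma approximableU B1 B2 : measurable B1 -> measurable B2 ->
  approximable B1 -> approximable B2 -> approximable (B1 `|` B2).
Proof.
move=> m1 m2 a1 a2 e e0; have e2 : 0 < e / 2 by rewrite divr_gt0.
have [n1 [D1 h1]] := a1 _ e2; have [n2 [D2 h2]] := a2 _ e2.
exists (maxn n1 n2), [set w | D1 (take n1 w) \/ D2 (take n2 w)].
have mD n D := @measurable_prefix_set N n D.
rewrite [X in _ < X]splitr; apply: le_lt_trans (ltrD h1 h2).
apply: le_trans (fine_probU _ _); try exact: measurable_symdiff.
apply: le_fine_prob.
- by apply: measurable_symdiff => //; exact: measurableU.
- by apply: measurableU; exact: measurable_symdiff.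
move=> x; rewrite /symdiff /= !take_prefix ?leq_maxl ?leq_maxr//.
move=> [[[Bx|Bx] nD]|[[Dx|Dx] nB]].
- by left; left; split=> // Dx; apply: nD; left.
- by right; left; split=> // Dx; apply: nD; right.
- by left; right; split=> // Bx; apply: nB; left.
- by right; right; split=> // Bx; apply: nB; right.
Qed.

(** By continuity from below, one set of the sequence carries almost all of the
    union. *)
Lemma approximable_bigcup (F : (set (strings N))^nat) :
  (forall i, measurable (F i)) -> nondecreasing_seq F ->
  (forall i, approximable (F i)) -> approximable (\bigcup_i F i).
Proof.
move=> mF ndF aF e e0; have e2 : 0 < e / 2 by rewrite divr_gt0.
have mU : measurable (\bigcup_i F i) by exact: bigcupT_measurable.
have : fine (mu (F n)) @[n --> \oo] --> fine (mu (\bigcup_i F i)).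
  by apply: fine_cvg; rewrite fine_probK//; exact: nondecreasing_cvg_mu.
move=> /cvgrPdist_lt /(_ _ e2)[n _ /(_ n (leqnn n))/= hn].
have [m [D hD]] := aF n _ e2; exists m, D.
have mD := @measurable_prefix_set N m D.
have mUF : measurable (\bigcup_i F i `\` F n) by exact: measurableD.
have hU : fine (mu (\bigcup_i F i `\` F n)) < e / 2.
  apply: le_lt_trans hn; apply: le_trans (ler_norm _).
  rewrite -lee_fin EFinB !fine_probK// measureD//; last first.
    by rewrite (le_lt_trans (probability_le1 mu mU))// ltry.
  rewrite setIidr//; exact: bigcup_sup.
rewrite [X in _ < X]splitr; apply: le_lt_trans (ltrD hU hD).
apply: le_trans (fine_probU _ _) => //; last exact: measurable_symdiff.
apply: le_fine_prob.
- exact: measurable_symdiff.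
- by apply: measurableU => //; exact: measurable_symdiff.
move=> x; rewrite /symdiff /= => -[[Ux nD]|[Dx nU]]; last first.
  by right; right; split=> // Fx; apply: nU; exists n.
have [Fx|nFx] := pselect (F n x); first by right; left.
by left.
Qed.

(** Sets depending on finitely many letters are dense among measurable sets. *)
Lemma measurable_approximable B : measurable B -> approximable B.
Proof.
suff: measurable `<=` [set B : set (strings N) | measurable B /\ approximable B].
  by move=> H /H[].
apply: smallest_sub; last first.
  move=> {}B oB; split; first exact: open_measurable_strings.
  pose F n := [set x | cylinder (string_prefix n x) `<=` B].
  have -> : B = \bigcup_n F n.
    apply/seteqP; split=> [x Bx|x [n _]]; last by apply; apply/cylinder_prefix.
    have /nbhs_cylinder[n nB] : nbhs x B by apply: open_nbhs_nbhs.
    by exists n.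
  apply: approximable_bigcup.
  - by move=> n; exact: (@measurable_prefix_set N n [set w | cylinder w `<=` B]).
  - move=> m n mn; apply/subsetPset => x /= xB y /cylinder_prefix xy.
    by apply: xB; apply/cylinder_prefix; apply: prefix_leq xy.
  - move=> n e e0; exists n, [set w | cylinder w `<=` B].
    by rewrite /symdiff setDv setU0 measure0.
have a0 : approximable set0.
  move=> e e0; exists 0%N, set0.
  by rewrite /symdiff set0D setU0 measure0.
split=> [|{}B [mB aB]|F HF].
- by split.
- by rewrite setTD; split; [exact: measurableC|exact: approximableC].
have mF i : measurable (F i) by have [] := HF i.
split; first exact: bigcupT_measurable.
have -> : \bigcup_i F i = \bigcup_n \big[setU/set0]_(i < n) F i.
  apply/seteqP; split=> x [n _].
    by exists n.+1 => //; rewrite big_ord_recr/=; right.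
  by rewrite -bigcup_mkord => -[k _ Fx]; exists k.
apply: approximable_bigcup.
- by move=> n; exact: bigsetU_measurable.
- by move=> m n mn; apply/subsetPset; exact: subset_bigsetU.
- elim=> [|n IH]; first by rewrite big_ord0.
  rewrite big_ord_recr/=; apply: approximableU => //.
    exact: bigsetU_measurable.
  by have [] := HF n.
Qed.

End approximation.


(** * Entropy of shift-invariant measures *)

Section kolmogorov_sinai.
Context (R : realType) (N : nat) (mu : probability (strings N) R).
Hypothesis imu : shift_invariant mu.
Local Notation A := 'I_N.+1.
Local Notation S := (@string_shift N).

Lemma fine_prob_bigU (I : finType) (F : I -> set (strings N))
    (B : set (strings N)) :
  measurable B -> (forall i, measurable (F i)) ->
  (forall x, B x -> exists i, F i x) ->
  fine (mu B) <= \sum_i fine (mu (F i)).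
Proof.
move=> mB mF BF.
suff [m1 h1] : measurable (\big[setU/set0]_i F i) /\
    fine (mu (\big[setU/set0]_i F i)) <= \sum_i fine (mu (F i)).
  apply: le_trans h1; apply: le_fine_prob => // x /BF[i Fx].
  by rewrite (bigD1 i)//=; left.
elim/big_ind2 : _ => [|C c D d' [mC Cc] [mD Dd]|i _]; first by rewrite measure0.
  split; first exact: measurableU.
  exact: le_trans (fine_probU mu mC mD) (lerD Cc Dd).
by split.
Qed.

(** Approximate each of the level sets of [xi] by a condition on a prefix, and
    let [f] pick a level whose condition holds. *)
Lemma guess_from_prefix (W : finType) (xi : strings N -> W) (dl : R) :
  finite_measurable xi -> 0 < dl -> exists k (f : k.-tuple A -> W),
    fine (mu [set x | xi x <> f (prefix_tuple k x)]) <= dl.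
Proof.
move=> mxi dl0; pose M : R := #|W|%:R.
have M0 : 0 < M by rewrite ltr0n; apply/card_gt0P; exists (xi point).
have e0 : 0 < dl / M by rewrite divr_gt0.
have /choice[nD HnD] : forall w : W, exists nD : nat * set (seq A),
    fine (mu (symdiff (xi @^-1` [set w])
      [set x | nD.2 (string_prefix nD.1 x)])) < dl / M.
  move=> w; have [n [D h]] := measurable_approximable mu (mxi w) e0.
  by exists (n, D).
pose k := \max_w (nD w).1; pose D w (t : seq A) := (nD w).2 (take (nD w).1 t).
pose f (t : k.-tuple A) : W := odflt (xi point) [pick w | `[< D w t >]].
exists k, f.
have DE w x : D w (prefix_tuple k x) <-> (nD w).2 (string_prefix (nD w).1 x).
  by rewrite /D /= take_prefix//; exact: (leq_bigmax w).
have mE w : measurable [set x : strings N | (nD w).2 (string_prefix (nD w).1 x)].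
  exact: measurable_prefix_set.
have mB : measurable [set x | xi x <> f (prefix_tuple k x)].
  have mp := finite_measurable_pair mxi (@finite_measurable_prefix N k).
  exact: (finite_measurable_preimage
    [set wt : W * k.-tuple A | wt.1 <> f wt.2] mp).
apply: le_trans (fine_prob_bigU mB (F := fun w => symdiff (xi @^-1` [set w])
      [set x | (nD w).2 (string_prefix (nD w).1 x)]) _ _) _.
- by move=> w; exact: measurable_symdiff.
- move=> x /=; rewrite /f; case: pickP => [w /asboolP/DE Dw xw|nD'].
    by exists w; right; split=> // xiw; apply: xw.
  move=> _; exists (xi x); left; split=> // /DE/asboolP.
  by rewrite nD'.
apply: le_trans (ler_sum _ (fun w _ => ltW (HnD w))) _.
by rewrite sumr_const -[X in X <= _]mulr_natr divfK// gt_eqF.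
Qed.

Definition first_letter (x : strings N) : A := x 0%N.

Let mS : measurable_fun setT S := @measurable_shift N.

Let ml : finite_measurable first_letter := finite_measurable_letter 0.

Definition block_entropy (n : nat) : R := entropy (fun t : n.-tuple A => cyl mu t).

Lemma block_entropyE n : block_entropy n = orbit_entropy mu S first_letter n.
Proof.
have mo : finite_measurable (orbit_word S first_letter n).
  exact: finite_measurable_orbit_word.
rewrite /block_entropy; under eq_fun do rewrite -law_prefix.
apply/eqP; rewrite eq_le; apply/andP; split.
  rewrite [X in entropy (law _ X)](_ : _ =
    (fun u : {ffun 'I_n -> A} => mktuple u) \o orbit_word S first_letter n).
    exact: entropy_law_comp.
  apply/funext => x; apply: eq_from_tnth => k /=.
  rewrite tnth_mktuple ffunE /first_letter iter_shiftE addn0.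
  by rewrite (tnth_nth ord0) /= nth_prefix.
rewrite /orbit_entropy [X in entropy (law _ X)](_ : _ =
    (fun t : n.-tuple A => [ffun k => tnth t k]) \o @prefix_tuple N n).
  apply: entropy_law_comp; exact: finite_measurable_prefix.
apply/funext => x; apply/ffunP => k; rewrite !ffunE /first_letter iter_shiftE addn0.
by rewrite (tnth_nth ord0) /= nth_prefix.
Qed.

Lemma block_entropy_ge0 n : 0 <= block_entropy n.
Proof. by rewrite block_entropyE; exact: orbit_entropy_ge0. Qed.

Lemma block_entropy_subadd m n :
  block_entropy (m + n) <= block_entropy m + block_entropy n.
Proof. by rewrite !block_entropyE; exact: orbit_entropy_subadd. Qed.

(** The prefixes of length [k] at the times before [n] are all read off the first
    [n + k] letters. *)
Lemma orbit_entropy_prefix k n :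
  orbit_entropy mu S (@prefix_tuple N k) n <= block_entropy n + block_entropy k.
Proof.
apply: le_trans (block_entropy_subadd n k); rewrite /block_entropy.
under [in leRHS]eq_fun do rewrite -law_prefix.
pose f (t : (n + k).-tuple A) : {ffun 'I_n -> k.-tuple A} :=
  [ffun j : 'I_n => mktuple (fun i : 'I_k => nth ord0 t (j + i))].
rewrite /orbit_entropy [X in entropy (law _ X)](_ : _ = f \o @prefix_tuple N (n + k)).
  by apply: entropy_law_comp; exact: finite_measurable_prefix.
apply/funext => x; apply/ffunP => j; rewrite !ffunE; apply: eq_from_tnth => i.
rewrite tnth_mktuple (tnth_nth ord0) /= nth_prefix// iter_shiftE nth_prefix//.
by rewrite -addSn leq_add// ltnW.
Qed.

Lemma partition_entropyE m (B : 'I_m -> set (strings N)) :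
  measurable_partition B -> exists2 xi : strings N -> 'I_m, finite_measurable xi &
  (forall a, B a = xi @^-1` [set a]) /\
  partition_entropy mu S B = (rate (orbit_entropy mu S xi))%:E.
Proof.
move=> [mB tB cB].
have /choice[xi Hxi] : forall x, exists a, B a x.
  by move=> x; have : setT x by []; rewrite -cB => -[a _]; exists a.
have BE a : B a = xi @^-1` [set a].
  apply/seteqP; split=> x /=; last by move=> <-.
  move=> Bx; apply: contrapT => /eqP ne.
  by have /trivIsetP/(_ _ _ I I ne)/seteqP[/(_ x)+ _] := tB; apply; split.
have mxi : finite_measurable xi by move=> a; rewrite -BE.
have jE n : join_entropy mu S n B = orbit_entropy mu S xi n.
  apply: eq_bigr => w _; rewrite /law.
  suff -> : join_atom S B w = orbit_word S xi n @^-1` [set w] by [].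
  apply/seteqP; split=> x /=.
    by move=> H; apply/ffunP => k; rewrite ffunE; have := H k; rewrite BE.
  by move=> <- k; rewrite ffunE BE.
exists xi => //; split=> //.
apply/cvg_lim => //; apply: cvg_EFin; first by near=> n.
rewrite (_ : fine \o _ = fun n => orbit_entropy mu S xi n / n%:R).
  by apply: fekete => [n|n1 n2]; [exact: orbit_entropy_ge0|exact: orbit_entropy_subadd].
by apply/funext => n /=; rewrite jE.
Unshelve. all: by end_near. Qed.

(** The partition by the first letter is a generator, so its entropy is the
    supremum. An arbitrary partition is predicted by the first [k] letters up to
    a small error, hence its orbit words of length [n] have at most the entropy
    of the words of length [n + k], plus a small cost per letter. *)
Theorem ks_entropyE : ks_entropy mu S = (rate block_entropy)%:E.
Proof.
apply/eqP; rewrite eq_le; apply/andP; split.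
  apply: ge_ereal_sup => _ [m [B [mB ->]]].
  have [xi mxi [_ ->]] := partition_entropyE mB.
  rewrite lee_fin; apply/ler_addgt0Pr => e e0.
  have e2 : 0 < e / 2 by rewrite divr_gt0.
  have [k Hk] : exists k, forall n, orbit_entropy mu S xi n <=
      block_entropy n + block_entropy k + n%:R * (e / 2).
    have [dl dl0 Hdl] := orbit_entropy_le_guess mS imu mxi e2.
    have [k [f Hf]] := guess_from_prefix mxi dl0.
    exists k => n; apply: le_trans (Hdl _ _ _ (@finite_measurable_prefix N k) Hf n) _.
    by rewrite lerD2r; exact: orbit_entropy_prefix.
  have e4 : 0 < e / 4 by rewrite divr_gt0.
  have := fekete block_entropy_ge0 block_entropy_subadd.
  move=> /cvgrPdist_le/(_ _ e4) Hfek.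
  near \oo => n.
  have n0 : (0 < n)%N by near: n; exists 1%N.
  have nR : 0 < n%:R :> R by rewrite ltr0n.
  have h1 : `|rate block_entropy - block_entropy n / n%:R| <= e / 4.
    by near: n.
  have h2 : block_entropy k <= e / 4 * n%:R.
    by rewrite mulrC -ler_pdivrMr//; near: n; exact: nbhs_infty_ger.
  have h3 : rate (orbit_entropy mu S xi) <= orbit_entropy mu S xi n / n%:R.
    by apply: rate_le => // j; exact: orbit_entropy_ge0.
  have h4 : orbit_entropy mu S xi n / n%:R <= block_entropy n / n%:R + e / 4 + e / 2.
    rewrite ler_pdivrMr// !mulrDl divfK ?gt_eqF//.
    by apply: le_trans (Hk n) _; rewrite [n%:R * _]mulrC lerD2r lerD2l.
  move: h1; rewrite ler_norml => /andP[h1 _]; lra.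
apply: ereal_sup_ubound.
exists N.+1, (fun a => first_letter @^-1` [set a]).
have mp : measurable_partition (fun a => first_letter @^-1` [set a]).
  split=> //.
  - by apply/trivIsetP => a b _ _ ab; apply/seteqP; split=> x //= [-> /eqP];
      rewrite (negbTE ab).
  - by apply/seteqP; split=> x // _; exists (first_letter x).
split => //.
have [xi _ [xiE ->]] := partition_entropyE mp.
congr (rate _)%:E; apply/funext => n; rewrite block_entropyE.
congr (orbit_entropy _ _ _ n); apply/funext => x.
have : (xi @^-1` [set xi x]) x by [].
by rewrite -xiE.
Unshelve. all: by end_near. Qed.

End kolmogorov_sinai.

(** * Weak convergence and empirical measures *)

Section weak_convergence.
Context (R : realType) (N : nat).
Local Notation A := 'I_N.+1.
Implicit Types (mu : probability (strings N) R) (f : strings N -> R).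

Lemma cvg_sum_seq (I J : Type) (F : set_system I) {FF : Filter F} (r : seq J)
    (u : J -> I -> R) (l : J -> R) :
  (forall j, u j i @[i --> F] --> l j) ->
  (\sum_(j <- r) u j i) @[i --> F] --> \sum_(j <- r) l j.
Proof.
move=> ul; elim: r => [|j r IH].
  rewrite big_nil; under eq_fun do rewrite big_nil; exact: cvg_cst.
by rewrite big_cons; under eq_fun do rewrite big_cons; exact: cvgD.
Qed.

Lemma bounded_strings f : continuous f -> exists K, forall x, `|f x| <= K.
Proof.
move=> cf; have [m Hm] := uniform_prefix cf (@ltr01 R).
exists (\sum_(t : m.-tuple A) `|f (pad t)| + 1) => x.
rewrite -[f x](subrK (f (pad (prefix_tuple m x)))) addrC.
apply: le_trans (ler_normD _ _) _; apply: lerD.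
  by rewrite (bigD1 (prefix_tuple m x))//= lerDl sumr_ge0.
apply: Hm; have := prefix_pad (string_prefix m x).
by rewrite size_prefix /=.
Qed.

Lemma integrable_bounded mu f (K : R) : measurable_fun setT f ->
  (forall x, `|f x| <= K) -> mu.-integrable setT (EFin \o f).
Proof.
move=> mf fK; apply: measurable_bounded_integrable => //.
  by rewrite /= probability_setT ltry.
by exists K; split; [exact: num_real|move=> M KM x _ /=; rewrite (le_trans (fK x))// ltW].
Qed.

Lemma integrable_continuous mu f : continuous f ->
  mu.-integrable setT (EFin \o f).
Proof.
move=> cf; have [K fK] := bounded_strings cf.
apply: integrable_bounded fK; exact: continuous_measurable_strings.
Qed.

Lemma prefix_funE m (g : seq A -> R) (x : strings N) : g (string_prefix m x) =
  \sum_(t : m.-tuple A) g t * \1_(cylinder t) x.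
Proof.
rewrite (bigD1 (prefix_tuple m x))//= big1 => [|t tx].
  by rewrite addr0 indicE mem_set ?mulr1//; exact/cylinder_prefix.
rewrite indicE memNset ?mulr0// => xt; case/negP: tx; apply/eqP.
by have : (prefix_tuple m @^-1` [set t]) x by rewrite prefix_tuple_cylinder.
Qed.

Lemma measurable_prefix_fun m (g : seq A -> R) :
  measurable_fun setT (fun x : strings N => g (string_prefix m x)).
Proof.
under eq_fun do rewrite prefix_funE.
apply: measurable_sum => t; apply: measurable_funM => //.
by apply: measurable_indic; exact: measurable_cylinder.
Qed.

Lemma integrable_prefix_fun mu m (g : seq A -> R) :
  mu.-integrable setT (EFin \o fun x : strings N => g (string_prefix m x)).
Proof.
apply: (@integrable_bounded _ _ (\sum_(t : m.-tuple A) `|g t|)).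
  exact: measurable_prefix_fun.
by move=> x; rewrite (bigD1 (prefix_tuple m x))//= lerDl sumr_ge0.
Qed.

Lemma Rintegral_prefix_fun mu m (g : seq A -> R) :
  \int[mu]_x g (string_prefix m x) = \sum_(t : m.-tuple A) g t * cyl mu t.
Proof.
rewrite /Rintegral.
under eq_integral do rewrite prefix_funE -sumEFin.
rewrite integral_sum//; last first.
  move=> t; apply: (@integrable_bounded _ (fun x => g t * \1_(cylinder t) x) `|g t|).
    apply: measurable_funM => //.
    by apply: measurable_indic; exact: measurable_cylinder.
  by move=> x; rewrite normrM ler_piMr// indicE; case: (_ \in _); rewrite ?normr1 ?normr0.
rewrite (eq_bigr (fun t : m.-tuple A => (g t * cyl mu t)%:E)); last first.
  move=> t _; under eq_integral do rewrite EFinM.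
  have mt := measurable_cylinder t.
  rewrite integralZl//; last first.
    by apply: (@integrable_bounded _ (\1_(cylinder t)) 1) => [|x];
      [exact: measurable_indic|rewrite indicE; case: (_ \in _); rewrite ?normr1 ?normr0].
  rewrite EFinM -cylE; congr (_ * _)%E.
  by have := integral_indic mu measurableT mt; rewrite setIT.
by rewrite sumEFin.
Qed.

Lemma Rintegral_near_prefix_fun mu f m (e : R) : continuous f ->
  (forall x y, string_prefix m x = string_prefix m y -> `|f x - f y| <= e) ->
  `|\int[mu]_x f x - \sum_(t : m.-tuple A) f (pad t) * cyl mu t| <= e.
Proof.
move=> cf Hm; rewrite -(Rintegral_prefix_fun mu m (fun w => f (pad w))).
have i1 := integrable_continuous mu cf.
have i2 := integrable_prefix_fun mu m (fun w => f (pad w)).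
have i12 : mu.-integrable setT (EFin \o (fun x => f x - f (pad (string_prefix m x)))).
  rewrite (_ : EFin \o _ = (EFin \o f) \- (EFin \o (fun x : strings N =>
    f (pad (string_prefix m x)))))%E; last by apply/funext.
  exact: integrableB.
rewrite -RintegralB//; apply: le_trans (le_normr_Rintegral _ i12) _ => //.
have -> : e = \int[mu]_x cst e x.
  rewrite Rintegral_cst// -[LHS]mulr1; congr (_ * _).
  exact/esym/(congr1 fine (probability_setT mu)).
apply: le_Rintegral => //.
- exact: (integrable_norm i12).
- exact: finite_measure_integrable_cst.
- move=> x _ /=; apply: Hm; have := prefix_pad (string_prefix m x).
  by rewrite size_prefix.
Qed.

Lemma cvg_Rintegral (I : Type) (F : set_system I) {FF : Filter F}
    (nu : I -> probability (strings N) R) mu f :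
  (forall w, cyl (nu i) w @[i --> F] --> cyl mu w) -> continuous f ->
  \int[nu i]_x f x @[i --> F] --> \int[mu]_x f x.
Proof.
move=> Hw cf; apply/cvgrPdist_le => e e0.
have e3 : 0 < e / 3 by rewrite divr_gt0.
have [m Hm] := uniform_prefix cf e3.
have : (\sum_(t : m.-tuple A) f (pad t) * cyl (nu i) t) @[i --> F] -->
    \sum_(t : m.-tuple A) f (pad t) * cyl mu t.
  by apply: cvg_sum_seq => t; apply: cvgMl_tmp; exact: Hw.
move=> /cvgrPdist_le/(_ _ e3); apply: filterS => i.
have h1 := Rintegral_near_prefix_fun mu cf Hm.
have h2 := Rintegral_near_prefix_fun (nu i) cf Hm.
move: h1 h2; rewrite !ler_norml => /andP[a1 a2] /andP[b1 b2] /andP[c1 c2].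
by apply/andP; split; lra.
Qed.

(** A continuous function is uniformly close to a function of a prefix, whose
    integral is a finite combination of masses of cylinders. *)
Lemma cvg_weak (I : Type) (F : set_system I) {FF : Filter F}
    (nu : I -> probability (strings N) R) mu :
  (forall w, cyl (nu i) w @[i --> F] --> cyl mu w) -> nu i @[i --> F] --> mu.
Proof.
move=> Hw B [_ [[W oW <-] Wmu WB]].
suff H : F [set i | W (integrals (nu i))] by apply: filterS H => i; exact: WB.
have : integrals (nu i) @[i --> F] --> integrals mu.
  apply/cvg_sup => f V [_ [[V' oV' <-] V'mu VV']].
  have := @cvg_Rintegral _ _ FF _ _ _ Hw (cts_fun (s := f)).
  have V'n : nbhs (\int[mu]_x f x) V' by apply: open_nbhs_nbhs.
  move=> /(_ _ V'n) FV'; apply: (@filterS _ F FF _ _ _ FV') => i; exact: VV'.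
apply; exact: open_nbhs_nbhs.
Qed.

Lemma continuous_Rintegral f : continuous f ->
  continuous (fun nu : probability (strings N) R => \int[nu]_x f x).
Proof.
move=> cf mu B Bmu.
have /= := @proj_continuous (continuousType (strings N) R) (fun=> R)
  (mkcts cf) (integrals mu) B Bmu.
exact: (@initial_continuous _ _ (@integrals R N) mu).
Qed.

Definition occurrences n (x : strings N) (w : seq A) : R :=
  \sum_(k < n) (string_prefix (size w) (iter k (@string_shift N) x) == w)%:R.

Lemma cyl_empirical n x w : (0 < n)%N ->
  cyl (empirical R n x) w = occurrences n x w / n%:R.
Proof.
move=> n0; rewrite /cyl empiricalE//.
rewrite (eq_bigr (fun k : 'I_n =>
  ((string_prefix (size w) (iter k (@string_shift N) x) == w)%:R)%:E)).
  by rewrite sumEFin -EFinM /= mulrC.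
move=> k _; rewrite diracE; congr ((nat_of_bool _)%:R%:E); apply/idP/eqP.
  by rewrite inE.
by move=> E; rewrite inE.
Qed.

Lemma Rintegral_empirical n x f : (0 < n)%N -> continuous f ->
  \int[empirical R n x]_y f y = birkhoff f n x / n%:R.
Proof.
move=> n0 cf; have nR : 0 < n%:R :> R by rewrite ltr0n.
apply/eqP; rewrite -subr_eq0 -normr_le0; apply/ler_addgt0Pr => e e0.
rewrite add0r; have e2 : 0 < e / 2 by rewrite divr_gt0.
have [m Hm] := uniform_prefix cf e2.
have h1 := Rintegral_near_prefix_fun (empirical R n x) cf Hm.
have : `|birkhoff f n x / n%:R -
    \sum_(t : m.-tuple A) f (pad t) * cyl (empirical R n x) t| <= e / 2.
  under eq_bigr do rewrite cyl_empirical// mulrA.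
  rewrite -mulr_suml -mulrBl normrM (gtr0_norm (x := n%:R^-1)) ?invr_gt0//.
  rewrite ler_pdivrMr// /birkhoff.
  rewrite (_ : \sum_(t : m.-tuple A) _ = \sum_(k < n)
      f (pad (string_prefix m (iter k (@string_shift N) x)))); last first.
    under eq_bigr do rewrite mulr_sumr.
    rewrite exchange_big/=; apply: eq_bigr => k _.
    rewrite (prefix_funE m (fun w => f (pad w))); apply: eq_bigr => t _.
    rewrite indicE size_tuple; congr (_ * (nat_of_bool _)%:R).
    by apply/eqP/idP; rewrite inE /cylinder /= size_tuple.
  rewrite -sumrB; apply: le_trans (ler_norm_sum _ _ _) _.
  rewrite mulr_natr -[n in leRHS]card_ord -sumr_const; apply: ler_sum => k _.
  apply: Hm; have := prefix_pad (string_prefix m (iter k (@string_shift N) x)).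
  by rewrite size_prefix.
move: h1; rewrite !ler_norml => /andP[a1 a2] /andP[b1 b2].
by apply/andP; split; lra.
Qed.

End weak_convergence.

(** * Measures with prescribed masses of cylinders *)

Section prescribed_cylinders.
Context (R : realType) (N : nat) (p : seq 'I_N.+1 -> R).
Local Notation A := 'I_N.+1.
Hypothesis p_nil : p [::] = 1.
Hypothesis p_ge0 : forall w, 0 <= p w.
Hypothesis p_rcons : forall w, p w = \sum_a p (rcons w a).

(** The intervals [[lower w, lower w + p w[] for the words of a given length
    follow one another in lexicographic order and partition [[0, 1[]. *)
Definition lower (w : seq A) : R :=
  \sum_(j < size w) \sum_(b : A | (b < nth ord0 w j)%N) p (rcons (take j w) b).

Definition interval_of (w : seq A) : set R := [set x | lower w <= x < lower w + p w].

Lemma lower_rcons w a :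
  lower (rcons w a) = lower w + \sum_(b : A | (b < a)%N) p (rcons w b).
Proof.
rewrite /lower size_rcons big_ord_recr/=; congr (_ + _).
  apply: eq_bigr => j _; rewrite nth_rcons ltn_ord.
  by rewrite -cats1 takel_cat// ltnW.
by rewrite nth_rcons ltnn eqxx -cats1 take_size_cat.
Qed.

Lemma upper_rcons w a : lower (rcons w a) + p (rcons w a) =
  lower w + \sum_(b : A | (b < a.+1)%N) p (rcons w b).
Proof.
rewrite lower_rcons -addrA; congr (_ + _).
rewrite [RHS](bigD1 a)//= addrC; congr (_ + _); apply: eq_bigl => b.
by rewrite ltnS ltn_neqAle andbC.
Qed.

Lemma partial_sum_le w (m n : nat) : (m <= n)%N ->
  \sum_(b : A | (b < m)%N) p (rcons w b) <= \sum_(b : A | (b < n)%N) p (rcons w b).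
Proof.
move=> mn; rewrite big_mkcond [leRHS]big_mkcond/=; apply: ler_sum => b _.
case: ifP => bm; first by rewrite (leq_trans bm mn).
by case: ifP.
Qed.

Lemma interval_of_rcons w a : interval_of (rcons w a) `<=` interval_of w.
Proof.
move=> x /andP[h1 h2]; apply/andP; split.
  by apply: le_trans h1; rewrite lower_rcons lerDl sumr_ge0.
apply: (lt_le_trans h2); rewrite upper_rcons lerD2l p_rcons.
rewrite big_mkcond/=; apply: ler_sum => b _; by case: ifP.
Qed.

Lemma interval_of_unit w : interval_of w `<=` `[0, 1[.
Proof.
elim/last_ind: w => [x|w a IH]; last exact: subset_trans (@interval_of_rcons _ _) IH.
by rewrite /interval_of /lower /= big_ord0 p_nil add0r in_itv.
Qed.

Lemma interval_of_inj w a b x : interval_of (rcons w a) x ->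
  interval_of (rcons w b) x -> a = b.
Proof.
wlog : a b / (a <= b)%N.
  by move=> H ha hb; case/orP: (leq_total a b) => ab; [|apply/esym]; apply: H ab _ _.
rewrite leq_eqVlt => /predU1P[ab _ _|ab /andP[_ h1] /andP[h2 _]]; first exact: val_inj.
suff : x < x by rewrite ltxx.
apply: lt_le_trans h1 _; apply: le_trans h2; rewrite upper_rcons lower_rcons lerD2l.
exact: partial_sum_le.
Qed.

Lemma interval_of_ex w x : interval_of w x -> exists a, interval_of (rcons w a) x.
Proof.
move=> /andP[h1 h2].
pose P n := (n < N.+1)%N && (lower w + \sum_(b : A | (b < n)%N) p (rcons w b) <= x).
have exP : exists n, P n.
  by exists 0%N; rewrite /P /= big_pred0 ?addr0.
have ubP n : P n -> (n <= N)%N by case/andP.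
case: (ex_maxnP exP ubP) => n /andP[nN hn] nmax.
exists (Ordinal nN); apply/andP; split; first by rewrite lower_rcons.
rewrite upper_rcons /= ltNge; apply/negP => hn1.
have [nN1|nN1] := ltnP n.+1 N.+1.
  by have := nmax n.+1; rewrite /P nN1 hn1 ltnn => /(_ isT).
have : x < x; last by rewrite ltxx.
apply: lt_le_trans h2 _; apply: le_trans hn1; rewrite lerD2l p_rcons.
rewrite [leRHS]big_mkcond/=; apply: ler_sum => b _.
by rewrite (leq_trans (ltn_ord b) nN1).
Qed.

(** The word of length [n] whose interval contains [x]. *)
Fixpoint address n (x : R) : seq A := if n is n'.+1 then
  rcons (address n' x)
    (odflt ord0 [pick a | `[< interval_of (rcons (address n' x) a) x >]])
  else [::].

Lemma size_address n x : size (address n x) = n.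
Proof. by elim: n => //= n IH; rewrite size_rcons IH. Qed.

Lemma addressP n x w : 0 <= x < 1 -> size w = n ->
  interval_of w x <-> address n x = w.
Proof.
move=> x01.
have H m : interval_of (address m x) x.
  elim: m => [|m IH]; first by rewrite /interval_of /lower /= big_ord0 p_nil add0r.
  have [a Ha] := interval_of_ex IH.
  by rewrite /=; case: pickP => [b /asboolP//|/(_ a)/asboolP].
move=> wn; split=> [|<-]; last exact: H.
elim/last_ind: w n wn => [|w a IH] n; first by move=> <-.
rewrite size_rcons => <- /= wax.
rewrite IH//; last exact: interval_of_rcons wax.
case: pickP => [b /asboolP wbx|/(_ a)/asboolP//] /=.
by rewrite (interval_of_inj wbx wax).
Qed.

(** Points outside the unit interval, a null set for [uniform_unit], are coded
    as [0]. *)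
Definition coding (x : measurableTypeR R) : strings N :=
  fun k => nth ord0 (address k.+1 (if 0 <= x < 1 then x else 0)) k.

Lemma take_address k n x : (k <= n)%N -> take k (address n x) = address k x.
Proof.
elim: n k => [|n IH] k; first by rewrite leqn0 => /eqP ->.
rewrite leq_eqVlt => /predU1P[->|kn]; first by rewrite take_oversize// size_address.
by rewrite /= -cats1 takel_cat ?IH// size_address.
Qed.

Lemma prefix_coding n x : string_prefix n (coding x) =
  address n (if 0 <= x < 1 then x else 0).
Proof.
apply: (@eq_from_nth _ ord0); rewrite size_prefix ?size_address// => k kn.
by rewrite nth_prefix// /coding -(take_address _ kn) nth_take.
Qed.

Lemma coding_cylinder w : coding @^-1` cylinder w =
  (`[0, 1[ `&` interval_of w) `|`
  (if address (size w) 0 == w then ~` `[0, 1[ else set0).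
Proof.
apply/seteqP; split=> x; rewrite /cylinder /= prefix_coding in_itv/=; last first.
  move=> [[x01 xw]|]; first by rewrite x01; apply/addressP.
  by case: eqP => //= aw; rewrite in_itv/= => /negP/negbTE ->.
case: ifP => x01 aw; first by left; split=> //; apply/(addressP x01 (erefl (size w))).
by right; rewrite aw eqxx /= in_itv/= x01.
Qed.

Lemma measurable_interval_of w : measurable (interval_of w).
Proof.
by rewrite (_ : interval_of w = `[lower w, lower w + p w[%classic).
Qed.

Lemma measurable_coding : measurable_fun setT coding.
Proof.
apply: (measurability _ (@measurable_cylindersE N)).
move=> _ [_ [->|[w ->]] <-]; rewrite setTI ?preimage_set0//.
rewrite coding_cylinder; apply: measurableU.
  by apply: measurableI => //; exact: measurable_interval_of.
by case: ifP => // _; apply: measurableC.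
Qed.

HB.instance Definition _ := @isMeasurableFun.Build _ _ _ _ coding measurable_coding.

Let unit_interval : measurable (`[0, 1[%classic : set (measurableTypeR R)).
Proof. exact: measurable_itv. Qed.

Definition uniform_unit : probability (measurableTypeR R) R :=
  mnormalize (mrestr (@lebesgue_measure R) unit_interval)
    \d_(0 : measurableTypeR R).

Lemma uniform_unitE (B : set R) : uniform_unit B = lebesgue_measure (B `&` `[0, 1[).
Proof.
have nE (m : {measure set (measurableTypeR R) -> \bar R}) P :
    m setT = 1%E -> mnormalize m P B = m B.
  by move=> E; rewrite /mnormalize E onee_eq0 /= invr1 mule1.
apply: etrans (nE _ _ _) _ => //=; rewrite /mrestr setTI.
rewrite lebesgue_measure_itv/=; by rewrite lte_fin ltr01 oppr0 adde0.
Qed.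

(** The cylinder of [w] pulls back under [coding] to the interval of [w], of
    length [p w], so the image of Lebesgue measure has the masses [p]. *)
Lemma prescribed_cylinders_ex :
  exists mu : probability (strings N) R, forall w, cyl mu w = p w.
Proof.
exists (distribution uniform_unit coding) => w.
rewrite /cyl /distribution /= /pushforward uniform_unitE coding_cylinder.
have -> : ((`[0, 1[ `&` interval_of w) `|`
    (if address (size w) 0 == w then ~` `[0, 1[ else set0)) `&` `[0, 1[ =
    `[lower w, lower w + p w[%classic.
  rewrite setIUl [X in X `|` _]setIAC setIid [X in _ `|` X](_ : _ = set0).
    rewrite setU0 setIidr//; exact: interval_of_unit.
  by case: ifP => _; rewrite ?setICl ?set0I.
rewrite lebesgue_measure_itv/= lte_fin ltrDl.
case: ltP => [_|p0]; first by rewrite -EFinD /= addrAC subrr add0r.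
by apply/esym/eqP; rewrite eq_le p0 p_ge0.
Qed.

End prescribed_cylinders.

(** * Contraction ratios of words *)

Section contraction.
Context (R : realType) (N : nat) (L : strings N -> R) (cmin cmax c : R).
Local Notation A := 'I_N.+1.
Local Notation S := (@string_shift N).
Hypothesis cmax_lt0 : cmax < 0.
Hypothesis L_bound : forall i, cmin <= L i <= cmax.
Hypothesis c_ge1 : 1 <= c.
Hypothesis L_distortion : forall (n : nat) (i j : strings N), (0 < n)%N ->
  string_prefix n i = string_prefix n j ->
  c^-1 <= expR (birkhoff L n i) / expR (birkhoff L n j) <= c.

Let c_gt0 : 0 < c. Proof. exact: lt_le_trans c_ge1. Qed.

Lemma birkhoffD m n x : birkhoff L (m + n) x =
  birkhoff L m x + birkhoff L n (iter m S x).
Proof.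
rewrite /birkhoff big_split_ord/=; congr (_ + _); apply: eq_bigr => k _.
by rewrite -iterD addnC.
Qed.

Lemma birkhoff_le n x : birkhoff L n x <= n%:R * cmax.
Proof.
rewrite mulr_natl -[n in leRHS]card_ord -sumr_const.
by apply: ler_sum => k _; have /andP[] := L_bound (iter k S x).
Qed.

Lemma birkhoff_ge n x : n%:R * cmin <= birkhoff L n x.
Proof.
rewrite mulr_natl -[n in leLHS]card_ord -sumr_const.
by apply: ler_sum => k _; have /andP[] := L_bound (iter k S x).
Qed.

Lemma birkhoff_distortion n x y : string_prefix n x = string_prefix n y ->
  birkhoff L n x <= birkhoff L n y + ln c.
Proof.
case: n => [_|n xy]; first by rewrite /birkhoff !big_ord0 add0r ln_ge0.
have /andP[_] := L_distortion (ltn0Sn n) xy.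
rewrite ler_pdivrMr ?expR_gt0// -{1}(lnK c_gt0) -expRD ler_expR.
by rewrite addrC.
Qed.

Definition ln_s (w : seq A) : R := ln (s_ L w).

Let image_has_sup w : has_sup [set expR (birkhoff L (size w) k) | k in cylinder w].
Proof.
split; first by exists (expR (birkhoff L (size w) (pad w))), (pad w) => //; exact: cylinder_pad.
exists (expR ((size w)%:R * cmax)) => _ [k _ <-].
by rewrite ler_expR birkhoff_le.
Qed.

Lemma s_ge w x : cylinder w x -> expR (birkhoff L (size w) x) <= s_ L w.
Proof.
move=> wx; apply: sup_ubound; last by exists x.
exact: (image_has_sup w).2.
Qed.

Lemma s_le w b : (forall x, cylinder w x -> expR (birkhoff L (size w) x) <= b) ->
  s_ L w <= b.
Proof.
move=> H; apply: ge_sup; first exact: (image_has_sup w).1.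
by move=> _ [x wx <-]; exact: H.
Qed.

Lemma s_gt0 w : 0 < s_ L w.
Proof. by apply: lt_le_trans (s_ge (cylinder_pad w)); exact: expR_gt0. Qed.

Lemma ln_s_ge w x : cylinder w x -> birkhoff L (size w) x <= ln_s w.
Proof.
move=> wx; rewrite -[leLHS]expRK ler_ln ?posrE ?expR_gt0 ?s_gt0//.
exact: s_ge.
Qed.

Lemma ln_s_le w b : (forall x, cylinder w x -> birkhoff L (size w) x <= b) ->
  ln_s w <= b.
Proof.
move=> H; rewrite -[leRHS]expRK ler_ln ?posrE ?expR_gt0 ?s_gt0//.
by apply: s_le => x wx; rewrite ler_expR; exact: H.
Qed.

Lemma ln_s_distortion w x : cylinder w x ->
  ln_s w <= birkhoff L (size w) x + ln c.
Proof.
move=> wx; apply: ln_s_le => y wy; apply: birkhoff_distortion.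
by rewrite wx wy.
Qed.

Lemma ln_s_take m w : (m <= size w)%N ->
  ln_s w <= ln_s (take m w) + (size w - m)%:R * cmax.
Proof.
move=> mw; apply: ln_s_le => x wx.
rewrite -{1}(subnKC mw) birkhoffD lerD ?birkhoff_le//.
have := @ln_s_ge (take m w) x; rewrite size_takel//; apply.
by rewrite /cylinder /= size_takel// -(take_prefix _ mw) wx.
Qed.

(** One letter changes [s_] by a bounded factor. This makes [s_ L w] comparable
    to [dl] when [s_approx L w dl]. *)
Lemma ln_s_parent w : w <> [::] ->
  ln_s (take (size w).-1 w) + cmin - ln c <= ln_s w.
Proof.
move=> w0; have sw : ((size w).-1.+1 = size w)%N by case: w w0.
have wp := cylinder_pad w.
apply: le_trans (ln_s_ge wp).
have := birkhoffD (size w).-1 1 (pad w); rewrite addn1 sw => ->.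
rewrite addrAC; apply: lerD; last first.
  by have := birkhoff_ge 1 (iter (size w).-1 S (pad w)); rewrite mul1r.
rewrite lerBlDr.
have := @ln_s_distortion (take (size w).-1 w) (pad w).
rewrite size_takel ?leq_pred//; apply.
rewrite /cylinder /= size_takel ?leq_pred//.
by have := take_prefix (pad w) (leq_pred (size w)); rewrite prefix_pad => ->.
Qed.

Lemma powR_s w t : s_ L w `^ t = expR (t * ln_s w).
Proof. by rewrite /powR gt_eqF// s_gt0. Qed.

Lemma s_approxP w dl : 0 < dl -> s_approx L w dl <->
  ln_s w <= ln dl < ln_s (take (size w).-1 w).
Proof.
move=> dl0; rewrite /s_approx /ln_s.
by rewrite ler_ln ?ltr_ln ?posrE ?s_gt0.
Qed.

Lemma s_approx_ge w dl : w <> [::] -> 0 < dl -> s_approx L w dl ->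
  ln dl - (ln c - cmin) <= ln_s w <= ln dl.
Proof.
move=> w0 dl0 /(s_approxP _ dl0)/andP[h1 h2]; rewrite h1 andbT.
apply: le_trans (ln_s_parent w0); move: h2; lra.
Qed.

End contraction.

Section counting.
Import finmap.

Lemma counting_le (R : realType) (T : choiceType) (B : set T) (M : R) :
  (forall F : {fset T}, [set` F] `<=` B -> #|` F|%:R <= M) ->
  (counting B <= M%:E)%E.
Proof.
move=> H; rewrite /counting; case: asboolP => [fB|iB].
  by rewrite lee_fin; apply: H; rewrite fset_setK.
have [F FB /(leq_trans (leqnn _)) nF] := infinite_set_fset (Num.truncn M).+1 iB.
have := H _ FB; rewrite leNgt => /negP; case.
apply: lt_le_trans (truncnS_gt M) _.
by rewrite ler_nat.
Qed.

Lemma counting_le_esum (R : realType) (T : choiceType) (D B : set T)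
    (a : T -> R) (b M : R) :
  (forall i, 0 <= a i) -> 0 < b -> B `<=` D -> (forall i, B i -> b <= a i) ->
  (\esum_(i in D) (a i)%:E <= M%:E)%E -> (counting B <= (M / b)%:E)%E.
Proof.
move=> a0 b0 BD ab aM; apply: counting_le => F FB.
rewrite ler_pdivlMr// -lee_fin; apply: le_trans aM.
apply: esum_ge; exists [set` F].
  by split; [exact: finite_fset|exact: subset_trans BD].
rewrite -(@fsbig_seq _ _ _ _ (enum_fset F)) ?fset_uniq// sumEFin lee_fin.
rewrite cardfE -sum1_card natr_sum mulr_suml.
rewrite [leRHS](_ : _ = \sum_(i : F) a (val i)); last by rewrite big_seq_fsetE.
by apply: ler_sum => i _; rewrite mul1r ab//; apply: FB; exact: fsvalP.
Qed.

End counting.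

(** * The spectrum is at most the abscissa *)

Section spectrum_le_abscissa.
Context (R : realType) (N : nat) (X : metricType R).
Context (U : probability (strings N) R -> X) (L : strings N -> R) (C : set X).
Hypothesis L_neg : bounded_negative L.
Hypothesis L_dist : bounded_distortion L.

(** If the series converges at [t] then, each word with [s_approx L w dl]
    contributing at least a constant times [dl `^ t] to its sum, the number of
    these words is at most a constant times [dl `^ (- t)]. *)
Lemma coarse_spectrum_at_le_zeta_abscissa (r : R) :
  (coarse_spectrum_at U L C r <= zeta_abscissa U L (cball C r))%E.
Proof.
have [cmin [cmax [_ cmax0 Lb]]] := L_neg; have [c c1 Ld] := L_dist.
apply: le_ereal_inf_tmp => _ [t /= sumt <-].
have a0 w : 0 <= s_ L w `^ t by exact: powR_ge0.
have [M M0 HM] : exists2 M : R, 0 < M &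
    (\esum_(w in zeta_strings U (cball C r)) (s_ L w `^ t)%:E <= M%:E)%E.
  move: sumt; rewrite /summable; under eq_esum do rewrite gee0_abs ?lee_fin//.
  set E := esum _ _ => Efin.
  have E0 : (0 <= E)%E by apply: esum_ge0 => w _; rewrite lee_fin.
  have Ef : E \is a fin_num by rewrite ge0_fin_numE.
  exists (fine E + 1); first by rewrite ltr_wpDl// fine_ge0.
  by rewrite EFinD fineK// leeDl// lee_fin.
(* The bound on the distance between [ln_s L w] and [ln dl]. *)
pose kap := ln c - cmin.
have kap0 : 0 <= kap.
  have := ln_ge0 c1; have /andP[h1 h2] := Lb point.
  by rewrite /kap; move: h1 h2 cmax0; lra.
pose K : R := ln M + `|t| * kap.
have cnt dl : 0 < dl -> (lne (counting (coarse_strings U L C r dl)) <=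
    (K - t * ln dl)%:E)%E.
  move=> dl0; pose b := expR (t * ln dl - `|t| * kap).
  have b0 : 0 < b by exact: expR_gt0.
  have Mb : (counting (coarse_strings U L C r dl) <= (M / b)%:E)%E.
    apply: counting_le_esum HM => // [w [w0 _ UL]|w [w0 sw _]]; first by split.
    rewrite /b (powR_s Lb) ler_expR.
    have /andP[h1 h2] := s_approx_ge Lb c1 Ld w0 dl0 sw.
    rewrite lerBlDr -lerBlDl -mulrBr.
    apply: le_trans (ler_norm _) _; rewrite normrM ler_wpM2l// ger0_norm.
      by rewrite /kap; lra.
    by rewrite subr_ge0.
  apply: (@le_trans _ _ (lne (M / b)%:E)).
    rewrite lee_lne// in_itv/= ?leey ?andbT.
      by rewrite /counting; case: asboolP => _; rewrite ?lee_fin ?leey.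
    by rewrite lee_fin divr_ge0// ltW.
  rewrite lne_EFin ?divr_gt0// lee_fin ln_div ?posrE// /b expRK /K; lra.
rewrite /coarse_spectrum_at limf_einfE.
apply: ge_ereal_sup => _ [V V0 <-]; apply/lee_addgt0Pr => e e0.
(* Below [d0], the constant [K] is less than [e] times [- ln dl]. *)
pose d0 := expR (- (`|K| / e + 1)).
have [dl [Vdl dl0 dld0]] : exists dl, [/\ V dl, 0 < dl & dl < d0].
  have : \forall dl \near 0^'+, [/\ V dl, 0 < dl & dl < d0].
    near=> dl; split; near: dl; [exact: V0|exact: nbhs_right_gt|].
    by apply: nbhs_right_lt; exact: expR_gt0.
  by move/filter_ex.
have lnd : `|K| / e + 1 < - ln dl.
  by rewrite ltrNr -[X in _ < X]expRK ltr_ln ?posrE ?expR_gt0.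
have lnd0 : 0 < - ln dl.
  by apply: lt_trans lnd; rewrite ltr_wpDl// divr_ge0// ltW.
apply: (@le_trans _ _ (lne (counting (coarse_strings U L C r dl)) /
    (- ln dl)%:E)%E); first by apply: ereal_inf_lbound; exists dl.
rewrite inver gt_eqF// lee_pdivrMr// -EFinD -EFinM.
apply: le_trans (cnt _ dl0) _; rewrite lee_fin.
rewrite mulrDl mulrN addrC lerD2l.
apply: le_trans (ler_norm K) _; rewrite -ler_pdivrMl// mulrC.
by move: lnd; lra.
Unshelve. all: by end_near. Qed.

End spectrum_le_abscissa.

(** * Sums over words *)

Lemma sum_tuple_rcons (R : realType) (B : finType) n (F : seq B -> R) :
  \sum_(t : n.+1.-tuple B) F t = \sum_(t : n.-tuple B) \sum_b F (rcons t b).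
Proof.
rewrite pair_big/=.
rewrite (reindex (fun ta : n.-tuple B * B => [tuple of rcons ta.1 ta.2]))//=.
exists (fun t : n.+1.-tuple B =>
    ([tuple tnth t (widen_ord (leqnSn n) i) | i < n], tnth t ord_max)).
  move=> [t b] _; congr (_, _).
    apply: eq_from_tnth => i; rewrite tnth_mktuple !(tnth_nth b)/=.
    by rewrite nth_rcons size_tuple ltn_ord.
  by rewrite (tnth_nth b) /= nth_rcons size_tuple ltnn eqxx.
move=> t _; have x0 := tnth t ord_max.
apply: eq_from_tnth => i; rewrite (tnth_nth x0) /= nth_rcons size_map size_enum_ord.
have [il|il] := ltnP i n.
  rewrite (nth_map (Ordinal il)) ?size_enum_ord//.
  by rewrite !(tnth_nth x0)/= nth_enum_ord.
have ii : i = n :> nat by apply/eqP; rewrite eqn_leq il -ltnS ltn_ord.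
by rewrite ii eqxx; congr (tnth t _); exact: val_inj.
Qed.

Section word_sums.
Context (R : realType) (N : nat).
Local Notation A := 'I_N.+1.

(** The weight of [w] when each letter is drawn from [k] given the letters
    before it. *)
Definition path_weight (k : seq A -> A -> R) (w : seq A) : R :=
  \prod_(j < size w) k (take j w) (nth ord0 w j).

Lemma path_weight_rcons k w a :
  path_weight k (rcons w a) = path_weight k w * k w a.
Proof.
rewrite /path_weight size_rcons big_ord_recr/= nth_rcons ltnn eqxx.
rewrite -cats1 take_size_cat//; congr (_ * _); apply: eq_bigr => j _.
by rewrite takel_cat ?(ltnW (ltn_ord j))// nth_cat ltn_ord.
Qed.

Lemma path_weight_gt0 (k : seq A -> A -> R) w :
  (forall u a, 0 < k u a) -> 0 < path_weight k w.
Proof. by move=> k0; exact: prodr_gt0. Qed.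

Lemma sum_path_weight_le1 (k : seq A -> A -> R) n :
  (forall u a, 0 <= k u a) -> (forall u, \sum_a k u a <= 1) ->
  \sum_(t : n.-tuple A) path_weight k t <= 1.
Proof.
move=> k0 k1; elim: n => [|n IH].
  rewrite (bigD1 [tuple])//= big1 ?addr0 /path_weight ?big_ord0// => t /negP[].
  by apply/eqP; exact: tuple0.
rewrite (sum_tuple_rcons _ (path_weight k)); apply: le_trans IH.
apply: ler_sum => t _; under eq_bigr do rewrite path_weight_rcons.
by rewrite -mulr_sumr ler_piMr// prodr_ge0.
Qed.

Lemma words_of_size n :
  [set w : seq A | size w = n] = [set tval t | t in [set: n.-tuple A]].
Proof.
apply/seteqP; split=> [w /= wn|_ [t _ <-]]; last exact: size_tuple.
by exists (Tuple (introT eqP wn)).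
Qed.

(** Sum over the lengths: a geometric series. *)
Lemma summable_words (a : seq A -> R) (rho : R) (D : set (seq A)) :
  0 <= rho < 1 -> (forall w, 0 <= a w) ->
  (forall n, \sum_(t : n.-tuple A) a t <= rho ^+ n) ->
  summable D (fun w => (a w)%:E).
Proof.
move=> /andP[rho0 rho1] a0 arho.
rewrite /summable; under eq_esum do rewrite gee0_abs ?lee_fin//.
have -> : \esum_(x in D) (a x)%:E =
    \esum_(x in setT) (if x \in D then (a x)%:E else 0%E).
  by rewrite [LHS]esum_mkcond.
apply: (@le_lt_trans _ _ (\esum_(x in [set: seq A]) (a x)%:E)%E).
  by apply: le_esum => x _; case: ifP => // _; rewrite lee_fin.
have -> : [set: seq A] = \bigcup_n [set w | size w = n].
  by apply/seteqP; split=> // w _; exists (size w).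
rewrite nneseries_sum_bigcup//; last first.
  by apply/trivIsetP => m n _ _ mn; apply/seteqP; split=> w //= [wm wn];
    rewrite -wm -wn eqxx in mn.
apply: (@le_lt_trans _ _ ((1 - rho)^-1)%:E); last by rewrite ltry.
apply: lime_le.
  by apply: is_cvg_nneseries => n _ _; apply: esum_ge0 => w _; rewrite lee_fin.
near=> m.
apply: (@le_trans _ _ (\sum_(0 <= n < m) (rho ^+ n)%:E)%E).
  apply: lee_sum => n _; rewrite words_of_size esum_image; last first.
    by move=> t u _ _; exact: val_inj.
  have fT : finite_set [set: n.-tuple A] by exact: finite_finset.
  rewrite esum_fset//; last by move=> t _; rewrite lee_fin.
  rewrite (_ : [set: n.-tuple A] = [set t | xpredT t]); last exact/seteqP.
  rewrite -(@bigfs _ _ _ _ (index_enum _) xpredT) ?index_enum_uniq//; last first.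
    by move=> t _; rewrite mem_index_enum.
  apply: (@le_trans _ _ (\sum_(t : n.-tuple A) a t)%:E); last by rewrite lee_fin.
  by rewrite -sumEFin.
rewrite sumEFin lee_fin.
have := geometric_seriesE 1 (negbT (lt_eqF rho1)).
rewrite /series /geometric /= => /(congr1 (fun f => f m)) /=.
under eq_bigr do rewrite mul1r; move=> ->.
rewrite mul1r ler_pdivrMr ?subr_gt0// mulVf ?gt_eqF ?subr_gt0//.
by rewrite gerBl exprn_ge0.
Unshelve. all: by end_near. Qed.

Lemma finite_words_lt n : finite_set [set w : seq A | (size w < n)%N].
Proof.
rewrite (_ : [set w | _] = \bigcup_(k in `I_n) [set w : seq A | size w = k]).
  apply: bigcup_finite => // k _; rewrite words_of_size.
  by apply: finite_image; exact: finite_finset.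
apply/seteqP; split=> w /=; first by move=> wn; exists (size w).
by move=> [k /= kn ->].
Qed.

End word_sums.

Section summable_sets.
Import finmap.
Context (R : realType) (T : choiceType) (a : T -> R).
Hypothesis a0 : forall i, 0 <= a i.

Lemma summable_subset (D E : set T) : D `<=` E ->
  summable E (fun i => (a i)%:E) -> summable D (fun i => (a i)%:E).
Proof.
move=> DE; rewrite /summable; apply: le_lt_trans.
apply: ge_ereal_sup => _ [F [fF FD] <-]; apply: ereal_sup_ubound.
by exists F => //; split=> //; exact: subset_trans DE.
Qed.

Lemma summableU (D E : set T) : summable D (fun i => (a i)%:E) ->
  summable E (fun i => (a i)%:E) -> summable (D `|` E) (fun i => (a i)%:E).
Proof.
move=> sD sE; rewrite /summable (esumID D)//.
apply: lte_add_pinfty; first by rewrite setUK.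
apply: le_lt_trans sE; apply: ge_ereal_sup => _ [F [fF FD] <-].
by apply: ereal_sup_ubound; exists F => //; split=> // x /FD[[]].
Qed.

Lemma summable_finite (D : set T) : finite_set D -> summable D (fun i => (a i)%:E).
Proof.
move=> fD; rewrite /summable esum_fset//.
by rewrite fsbig_finite//=; apply: lte_sum_pinfty => i _; exact: ltry.
Qed.

Lemma le_summable (b : T -> R) (K : R) (D : set T) :
  (forall i, D i -> b i <= K * a i) -> (forall i, 0 <= b i) ->
  summable D (fun i => (a i)%:E) -> summable D (fun i => (b i)%:E).
Proof.
move=> ba b0; rewrite /summable => sD.
have E0 : (0 <= \esum_(x in D) `|(a x)%:E|)%E by exact: esum_ge0.
have Ef : (\esum_(x in D) `|(a x)%:E|)%E \is a fin_num by rewrite ge0_fin_numE.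
apply: (@le_lt_trans _ _ (`|K| * fine (\esum_(x in D) `|(a x)%:E|)%E)%:E); last exact: ltry.
apply: ge_ereal_sup => _ [F [fF FD] <-].
have sE (f : T -> R) : (forall i, 0 <= f i) ->
    (\sum_(x \in F) `|(f x)%:E| = (\sum_(x <- enum_fset (fset_set F)) f x)%:E)%E.
  move=> f0; rewrite fsbig_finite//= -sumEFin.
  by apply: eq_bigr => i _; rewrite ger0_norm.
rewrite sE// lee_fin.
apply: (@le_trans _ _ (`|K| * \sum_(x <- enum_fset (fset_set F)) a x)).
  rewrite mulr_sumr big_seq [leRHS]big_seq; apply: ler_sum => i.
  rewrite in_fset_set// => /set_mem/FD Di; apply: le_trans (ba _ Di) _.
  by rewrite ler_wpM2r// ler_norm.
rewrite ler_wpM2l// -lee_fin fineK// -sE//.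
by apply: ereal_sup_ubound; exists F.
Qed.

End summable_sets.

(** Compactness of the segment, read through ultrafilters. *)
Lemma ultra_cvg (R : realType) (I : Type) (G : set_system I) (phi : I -> R) (a b : R) :
  UltraFilter G -> (forall i, a <= phi i <= b) -> exists l : R, phi i @[i --> G] --> l.
Proof.
move=> UG ab; have PG : ProperFilter G by exact: ultra_proper.
have := @segment_compact R a b.
move=> /(_ (phi @ G) _)[|l [_ cl]].
  change (G (phi @^-1` `[a, b])); apply: filterE => i.
  by rewrite /= in_itv/=; exact: ab.
exists l => V Vl.
have [//|H] := in_ultra_setVsetC (phi @^-1` V) UG.
have [x []] := cl (~` V) V H Vl.
by [].
Qed.

(** * The abscissa is at most the supremum *)

Section markov_weights.
Context (R : realType) (N : nat) (mu : probability (strings N) R).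
Context (l : nat) (kap : R).
Local Notation A := 'I_N.+1.
Local Notation S := (@string_shift N).
Local Notation p := (cyl mu).
Local Notation M := (N.+1%:R : R).
Hypothesis kap01 : 0 < kap < 1.

(** The conditional probability of the letter [a] after [v], mixed with the
    uniform law to keep it away from [0]. If [p v = 0], the quotient is [0]. *)
Definition smoothed (v : seq A) (a : A) : R :=
  kap / M + (1 - kap) * (p (rcons v a) / p v).

(** The chain of memory [l]; at the start it sees the whole past, as the
    subtraction is truncated. *)
Definition markov_kernel (u : seq A) (a : A) : R :=
  smoothed (drop (size u - l) u) a.

Definition transition_cost (t : seq A) : R :=
  - ln (smoothed (take l t) (nth ord0 t l)).

Let kap0 : 0 < kap. Proof. by have /andP[] := kap01. Qed.
Let kap1 : 0 < 1 - kap. Proof. by have /andP[] := kap01; rewrite subr_gt0. Qed.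
Let kM0 : 0 < kap / M. Proof. by rewrite divr_gt0. Qed.

Lemma smoothed_ge v a : kap / M <= smoothed v a.
Proof. by rewrite lerDl mulr_ge0 ?divr_ge0 ?cyl_ge0// ltW. Qed.

Lemma smoothed_gt0 v a : 0 < smoothed v a.
Proof. exact: lt_le_trans (smoothed_ge v a). Qed.

Lemma sum_smoothed v : \sum_a smoothed v a <= 1.
Proof.
rewrite big_split/= sumr_const card_ord -mulr_sumr -mulr_suml -cyl_rcons.
rewrite -[X in X + _]mulr_natr divfK ?pnatr_eq0//.
have [->|p0] := eqVneq (p v) 0; first by rewrite mul0r mulr0 addr0; move: kap1; lra.
by rewrite divff// mulr1 addrC subrK.
Qed.

Lemma smoothed_le1 v a : smoothed v a <= 1.
Proof.
apply: le_trans (sum_smoothed v); rewrite (bigD1 a)//= lerDl.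
by apply: sumr_ge0 => b _; exact/ltW/smoothed_gt0.
Qed.

(** The first [l] letters cost at most [- ln (kap / M)] each. The cost of each
    later letter is a function of the window of length [l.+1] that it ends; the
    [l] windows that leave the word only add nonnegative terms. *)
Lemma markov_weight_cost n (x : strings N) :
  - ln (path_weight markov_kernel (string_prefix n x)) <=
  l%:R * - ln (kap / M) +
  \sum_(k < n) transition_cost (string_prefix l.+1 (iter k S x)).
Proof.
pose f j := - ln (markov_kernel (string_prefix j x) (x j)).
have f0 j : 0 <= f j by rewrite oppr_ge0 ln_le0// smoothed_le1.
have -> : - ln (path_weight markov_kernel (string_prefix n x)) = \sum_(j < n) f j.
  rewrite /path_weight size_prefix ln_prod => [|j]; last exact: smoothed_gt0.
  rewrite -sumrN; apply: eq_bigr => j _.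
  by rewrite take_prefix ?(ltnW (ltn_ord j))// nth_prefix.
apply: (@le_trans _ _ (\sum_(j < l + n) f j)).
  by rewrite addnC big_split_ord/= lerDl sumr_ge0.
rewrite big_split_ord/=; apply: lerD.
  rewrite mulr_natl -[l in leRHS]card_ord -sumr_const; apply: ler_sum => j _.
  by rewrite lerN2 ler_ln ?posrE ?smoothed_gt0// smoothed_ge.
apply: ler_sum => j _; rewrite /f /markov_kernel /transition_cost size_prefix addKn.
rewrite take_prefix// nth_prefix// iter_shiftE addnC.
by rewrite prefix_iter_shift addnC.
Qed.

(** Under [mu] the mean cost of a letter is, but for the smoothing, the
    conditional entropy of a letter given the [l] letters before it. *)
Lemma transition_cost_mean :
  \sum_(t : l.+1.-tuple A) transition_cost t * p t <=
  - ln (1 - kap) + (block_entropy mu l.+1 - block_entropy mu l).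
Proof.
have sum1 n : \sum_(t : n.-tuple A) p t = 1.
  rewrite -(law_sum1 mu (@finite_measurable_prefix N n)).
  by apply: eq_bigr => t _; rewrite law_prefix.
apply: (@le_trans _ _ (\sum_(t : l.+1.-tuple A)
    (- ln (1 - kap) * p t + (- (p t * ln (p t)) + p t * ln (p (take l t)))))).
  apply: ler_sum => t _.
  have [->|pt] := eqVneq (p t) 0; first by rewrite !(mul0r, mulr0) oppr0 !addr0.
  have pt0 : 0 < p t by rewrite lt_neqAle eq_sym pt cyl_ge0.
  have tE : t = rcons (take l t) (nth ord0 t l) :> seq A.
    by rewrite -take_nth ?size_tuple// take_oversize// size_tuple.
  have pl0 : 0 < p (take l t).
    apply: lt_le_trans pt0 _; rewrite [in leLHS]tE [leRHS]cyl_rcons.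
    by rewrite (bigD1 (nth ord0 t l))//= lerDl sumr_ge0// => a _; exact: cyl_ge0.
  rewrite [- ln (1 - kap) * _]mulrC -mulrN -!mulrDr [leLHS]mulrC.
  rewrite ler_wpM2l ?cyl_ge0// /transition_cost.
  suff : ln (1 - kap) + (ln (p t) - ln (p (take l t))) <=
      ln (smoothed (take l t) (nth ord0 t l)) by lra.
  rewrite -ln_div ?posrE// -lnM ?posrE ?divr_gt0//.
  rewrite ler_ln ?posrE ?smoothed_gt0 ?mulr_gt0 ?divr_gt0 ?invr_gt0//.
  by rewrite /smoothed -tE lerDr ltW.
rewrite !big_split/= -mulr_sumr sum1 mulr1 lerD2l lerD2l.
rewrite (sum_tuple_rcons _ (fun t => p t * ln (p (take l t)))).
rewrite /block_entropy /entropy -sumrN; apply: ler_sum => t _.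
rewrite opprK [X in _ <= X * _]cyl_rcons mulr_suml; apply: ler_sum => a _.
by rewrite -cats1 take_size_cat ?size_tuple.
Qed.

End markov_weights.

Section occurrences.
Context (R : realType) (N : nat).
Local Notation A := 'I_N.+1.
Local Notation S := (@string_shift N).

Lemma sum_occurrences n m (x : strings N) (g : seq A -> R) :
  \sum_(k < n) g (string_prefix m (iter k S x)) =
  \sum_(t : m.-tuple A) g t * occurrences R n x t.
Proof.
under [RHS]eq_bigr do rewrite mulr_sumr.
rewrite exchange_big/=; apply: eq_bigr => k _.
rewrite (prefix_funE m g); apply: eq_bigr => t _.
rewrite indicE size_tuple; congr (_ * (nat_of_bool _)%:R).
by apply/idP/eqP; rewrite inE /cylinder /= size_tuple.
Qed.

Lemma sum_prefix_empirical n m (x : strings N) (g : seq A -> R) : (0 < n)%N ->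
  \sum_(k < n) g (string_prefix m (iter k S x)) =
  n%:R * \sum_(t : m.-tuple A) g t * cyl (empirical R n x) t.
Proof.
move=> n0; rewrite sum_occurrences mulr_sumr; apply: eq_bigr => t _.
by rewrite cyl_empirical// mulrCA [n%:R * _]mulrC divfK// pnatr_eq0 -lt0n.
Qed.

(** Shifting the word drops the first term of the average and adds one at the
    end. *)
Lemma cyl_empirical_shift n (x : strings N) w : (0 < n)%N ->
  `|cyl (empirical R n x) w - \sum_a cyl (empirical R n x) (a :: w)| <= n%:R^-1.
Proof.
move=> n0; rewrite cyl_empirical//.
under eq_bigr do rewrite cyl_empirical//.
rewrite -mulr_suml -mulrBl normrM (ger0_norm (x := n%:R^-1)) ?invr_ge0// ler_piMl ?invr_ge0//.
pose f k : R := (string_prefix (size w) (iter k S x) == w)%:R.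
have -> : \sum_a occurrences R n x (a :: w) = \sum_(k < n) f k.+1.
  rewrite exchange_big/=; apply: eq_bigr => k _.
  have E a : (string_prefix (size w).+1 (iter k S x) == a :: w) =
      (iter k S x 0%N == a) && (string_prefix (size w) (iter k.+1 S x) == w).
    apply/eqP/andP => [/cylinder_cons[-> ->]|[/eqP xa /eqP xw]]; first by rewrite !eqxx.
    by apply/cylinder_cons.
  rewrite (bigD1 (iter k S x 0%N))//= E eqxx big1 ?addr0// => a /negbTE xa.
  by rewrite E eq_sym xa.
have -> : occurrences R n x w = \sum_(k < n) f k by [].
have -> : \sum_(k < n) f k - \sum_(k < n) f k.+1 = f 0%N - f n.
  rewrite -opprB -sumrB -(big_mkord xpredT (fun k => f k.+1 - f k)).
  by rewrite telescope_sumr// opprB.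
rewrite /f; do 2![case: eqP => _] => /=; rewrite ?subrr ?subr0 ?sub0r ?normrN ?normr0 ?normr1//.
Qed.

End occurrences.

Section abscissa_le_supremum.
Context (R : realType) (N : nat) (X : metricType R).
Context (U : probability (strings N) R -> X) (L : strings N -> R) (C : set X).
Local Notation A := 'I_N.+1.
Local Notation S := (@string_shift N).
Hypothesis U_cont : continuous U.
Hypothesis L_cont : continuous L.
Hypothesis L_neg : bounded_negative L.
Hypothesis L_dist : bounded_distortion L.
Hypothesis C_closed : closed C.
Variable t : R.
Hypothesis not_summable : forall r : R, 0 < r ->
  ~ summable (zeta_strings U (cball C r)) (fun i => (s_ L i `^ t)%:E).

Let D r := zeta_strings U (cball C r).
Let term i := s_ L i `^ t.
Let nu (i : seq A) : probability (strings N) R := empirical R (size i) (pad i).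

Let term0 i : 0 <= term i. Proof. exact: powR_ge0. Qed.

Lemma cball_subset (r1 r2 : R) : r1 <= r2 -> cball C r1 `<=` cball C r2.
Proof. by move=> r12 x; rewrite /cball /= => /le_trans; apply; rewrite lee_fin. Qed.

(** Words outside a set of this filter contribute a convergent series for some
    [r], so the divergence of all the series is carried by the set. *)
Definition divergence_filter : set_system (seq A) := fun B =>
  exists2 r, 0 < r & summable (D r `\` B) (fun i => (term i)%:E).

Lemma divergence_filter_proper : ProperFilter divergence_filter.
Proof.
split; first by move=> [r r0]; rewrite setD0; exact: not_summable.
split.
- by exists 1 => //; rewrite setDT; apply: summable_finite.
- move=> B1 B2 [r1 r10 s1] [r2 r20 s2]; exists (Num.min r1 r2).
    by rewrite lt_min r10.
  have sU := summableU s1 s2; apply: summable_subset _ sU => w [[w0 wU] nB].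
  have [B1w|B1w] := pselect (B1 w); [right|left]; split => //.
  + by split=> // x /wU; apply: cball_subset; rewrite ge_min lexx orbT.
  + by move=> B2w; apply: nB.
  + by split=> // x /wU; apply: cball_subset; rewrite ge_min lexx.
- move=> B1 B2 B12 [r r0 s1]; exists r => //.
  by apply: summable_subset _ s1 => w [Dw nB]; split=> // /B12.
Qed.

(** Every set of an ultrafilter finer than [divergence_filter] still carries a
    divergent series: the complement of a set with a convergent one is in
    [divergence_filter]. *)
Lemma exists_divergence_ultrafilter : exists G : set_system (seq A),
  [/\ UltraFilter G,
      forall r, 0 < r -> G (D r),
      forall n, G [set w | (n <= size w)%N] &
      forall B, G B -> ~ summable B (fun i => (term i)%:E)].
Proof.
have PF := divergence_filter_proper.
have [G [UG FG]] := ultraFilterLemma PF.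
have PG : ProperFilter G by exact: ultra_proper.
exists G; split=> //.
- by move=> r r0; apply: FG; exists r => //; rewrite setDv; apply: summable_finite.
- move=> n; apply: FG; exists 1 => //; apply: summable_finite => //.
  apply: sub_finite_set (finite_words_lt N n) => w [_ /= /negP].
  by rewrite -ltnNge.
- move=> B GB sB; have : G (~` B).
    apply: FG; exists 1 => //; rewrite setDE setCK.
    by apply: summable_subset _ sB => w [].
  by move=> GB'; have [w []] := filter_ex (filterI GB GB').
Qed.

(** Here the divergence is turned into entropy. The Markov weights [Q] of order
    [l] of [mu] have sum at most [1] over the words of each length [n]. A word
    [i] whose empirical measure is close to [mu] has [- ln (Q i)] about [n] times
    the entropy increment, and [ln (term i)] about [n] times the integral of
    [t * L]. If the sum [E] of the two were negative, [term i] would be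
    exponentially smaller than [Q i], and these words would contribute a
    convergent series. *)
Lemma entropy_increment_ge (G : set_system (seq A))
    (mu : probability (strings N) R) l : UltraFilter G ->
  (forall n, G [set w | (n <= size w)%N]) ->
  (forall B, G B -> ~ summable B (fun i => (term i)%:E)) ->
  (forall w, cyl (nu i) w @[i --> G] --> cyl mu w) ->
  0 <= block_entropy mu l.+1 - block_entropy mu l + t * \int[mu]_x L x.
Proof.
move=> UG Gn Gdiv Gcyl; have PG : ProperFilter G by exact: ultra_proper.
have [cmin [cmax [_ cmax0 Lb]]] := L_neg; have [c c1 Ld] := L_dist.
rewrite leNgt; apply/negP => neg.
set E := _ + _ in neg.
(* Of the four parts [e] of [- E], one pays for the smoothing, two for the
   distance from the empirical measure to [mu] in the two integrals, and the
   last one is the rate of decay. *)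
pose e := - E / 4.
have e0 : 0 < e by rewrite divr_gt0// oppr_gt0.
pose kap := 1 - expR (- e).
have kap01 : 0 < kap < 1.
  by rewrite /kap subr_gt0 -{1}expR0 ltr_expR oppr_lt0 e0 /= gtrBl expR_gt0.
have lkap : - ln (1 - kap) = e by rewrite /kap opprB addrC subrK expRK opprK.
pose g := transition_cost mu l kap.
pose B := [set i | [/\ (1 <= size i)%N,
   \sum_(t : l.+1.-tuple A) g t * cyl (nu i) t <=
     \sum_(t : l.+1.-tuple A) g t * cyl mu t + e &
   t * \int[nu i]_x L x <= t * \int[mu]_x L x + e]].
have GB : G B.
  have h1 : (\sum_(t : l.+1.-tuple A) g t * cyl (nu i) t) @[i --> G] -->
      \sum_(t : l.+1.-tuple A) g t * cyl mu t.
    by apply: cvg_sum_seq => u; apply: cvgMl_tmp; exact: Gcyl.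
  have h2 : t * \int[nu i]_x L x @[i --> G] --> t * \int[mu]_x L x.
    by apply: cvgMl_tmp; apply: cvg_Rintegral.
  move/cvgrPdist_le : h1 => /(_ _ e0) h1; move/cvgrPdist_le : h2 => /(_ _ e0) h2.
  apply: filterS3 (Gn 1%N) h1 h2 => i i0; rewrite !ler_norml.
  by move=> /andP[a1 a2] /andP[b1 b2]; split=> //; lra.
apply: Gdiv GB _.
pose Q i := path_weight (markov_kernel mu l kap) i.
have Q0 i : 0 < Q i by apply: path_weight_gt0 => u a; exact: smoothed_gt0.
pose K := `|t| * ln c + l%:R * - ln (kap / N.+1%:R).
apply: (@le_summable _ _ (fun i => Q i * expR (- e) ^+ size i) _ _ (expR K)) => //; first 2 last.
- apply: (@summable_words _ _ _ (expR (- e))).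
  + by rewrite expR_ge0 /= -expR0 ltr_expR oppr_lt0.
  + by move=> w; rewrite mulr_ge0 ?exprn_ge0 ?expR_ge0// ltW.
  + move=> n; under eq_bigr do rewrite size_tuple.
    rewrite -mulr_suml ler_piMl ?exprn_ge0 ?expR_ge0//.
    apply: sum_path_weight_le1 => [u a|u]; first exact/ltW/smoothed_gt0.
    exact: sum_smoothed.
- by move=> w; rewrite mulr_ge0 ?exprn_ge0 ?expR_ge0// ltW.
move=> i [i1 i2 i3].
rewrite /term (powR_s Lb) -[Q i]lnK ?posrE// -expRM_natl -!expRD ler_expR.
have w1 := markov_weight_cost mu l kap01 (size i) (pad i).
rewrite prefix_pad sum_prefix_empirical// -/(Q i) -/(nu i) in w1.
have w2 : t * ln_s L i <= (size i)%:R * (t * \int[nu i]_x L x) + `|t| * ln c.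
  rewrite Rintegral_empirical// mulrCA [(size i)%:R * _]mulrC divfK ?pnatr_eq0 -?lt0n//.
  rewrite -lerBlDl -mulrBr; apply: le_trans (ler_norm _) _.
  rewrite normrM ler_wpM2l// ger0_norm ?subr_ge0.
    by rewrite lerBlDl (ln_s_distortion Lb c1 Ld)//; exact: cylinder_pad.
  by rewrite (ln_s_ge Lb)//; exact: cylinder_pad.
have n0 : 0 <= (size i)%:R :> R by [].
have w3 := ler_wpM2l n0 i2; have w4 := ler_wpM2l n0 i3.
have w5 := ler_wpM2l n0 (transition_cost_mean mu l kap01).
rewrite -/g lkap in w5.
have w6 : (size i)%:R * E = (size i)%:R * (- 4 * e) by rewrite /e; field.
move: w1 w2 w3 w4 w5 w6; rewrite -/g /K /E; lra.
Qed.

(** The limit of the empirical measures along the ultrafilter. It is defined by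
    the limits of the masses of cylinders. It is invariant, as the lengths tend
    to infinity; [U] sends it to a limit of points close to [C], hence into [C]
    by closedness; and the increments of its block entropies, bounded below by
    [entropy_increment_ge], add up to the bound on the rate. *)
Theorem exists_invariant_measure : exists mu : probability (strings N) R,
  [/\ shift_invariant mu, C (U mu) &
      0 <= rate (block_entropy mu) + t * \int[mu]_x L x].
Proof.
have [G [UG GD Gn Gdiv]] := exists_divergence_ultrafilter.
have PG : ProperFilter G by exact: ultra_proper.
have /choice[p Hp] : forall w, exists l : R, cyl (nu i) w @[i --> G] --> l.
  move=> w; apply: (@ultra_cvg _ _ _ _ 0 1) => // i.
  by rewrite cyl_ge0 -lee_fin -cylE probability_le1//; exact: measurable_cylinder.
have [mu Hmu] : exists mu : probability (strings N) R, forall w, cyl mu w = p w.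
  apply: prescribed_cylinders_ex.
  - have := Hp [::]; under eq_fun do rewrite cyl_nil.
    move/(cvg_unique (@Rhausdorff R)); apply; exact: cvg_cst.
  - move=> w; apply: (cvgr_to_ge (Hp w)).
    by apply: filterE => i; exact: cyl_ge0.
  - move=> w; have Hs : cyl (nu i) w @[i --> G] --> \sum_a p (rcons w a).
      under eq_fun do rewrite cyl_rcons.
      by apply: cvg_sum_seq => a; exact: Hp.
    exact: (cvg_unique (@Rhausdorff R) (Hp w) Hs).
have Gcyl w : cyl (nu i) w @[i --> G] --> cyl mu w by rewrite Hmu.
have imu : shift_invariant mu.
  apply: shift_invariant_cyl => w; apply/eqP; rewrite -subr_eq0; apply/eqP.
  pose u i := cyl (nu i) w - \sum_a cyl (nu i) (a :: w).
  have u1 : u i @[i --> G] --> cyl mu w - \sum_a cyl mu (a :: w).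
    by apply: cvgB => //; apply: cvg_sum_seq => a; exact: Gcyl.
  apply: (cvg_unique (@Rhausdorff R) u1).
  apply/cvgrPdist_le => e e0.
  apply: filterS (Gn (Num.truncn e^-1).+1) => i /= ei.
  have i0 : (0 < size i)%N by exact: leq_trans ei.
  rewrite sub0r normrN; apply: le_trans (@cyl_empirical_shift R N (size i) (pad i) w i0) _.
  rewrite invf_ple ?posrE ?ltr0n//; apply: le_trans (ltW (truncnS_gt _)) _.
  by rewrite ler_nat.
exists mu; split=> //.
- have GU : U (nu i) @[i --> G] --> U mu.
    by apply: (cvg_comp _ _ (cvg_weak Gcyl)); exact: U_cont.
  apply: C_closed => B /nbhs_ballP[e /= e0 eB].
  have e2 : 0 < e / 2 by rewrite divr_gt0.
  have e4 : 0 < e / 4 by rewrite divr_gt0.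
  have GB : G [set i | ball (U mu) (e / 2) (U (nu i))].
    by apply: GU; exact: nbhsx_ballx.
  have [i [/= Bi [_ Di]]] := filter_ex (filterI GB (GD _ e4)).
  have /Di : UL U i (U (nu i)) by exists (pad i) => //; exact: cylinder_pad.
  rewrite /cball /= => le4.
  have : (ereal_inf [set (mdist (U (nu i)) y)%:E | y in C] < (e / 2)%:E)%E.
    by apply: le_lt_trans le4 _; rewrite lte_fin ltr_pM2l// ltf_pV2 ?posrE// ltr_nat.
  move=> /ereal_inf_lt[_ [y Cy <-]]; rewrite lte_fin => yi.
  exists y; split=> //; apply: eB; rewrite [e]splitr.
  by apply: ball_triangle Bi _; rewrite ballEmdist.
- rewrite addrC -lerBlDl sub0r; apply: le_rate => [n|n _]; first exact: block_entropy_ge0.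
  elim: n => [|n IH]; first by rewrite mulr0 block_entropy_ge0.
  have := entropy_increment_ge n UG Gn Gdiv Gcyl.
  by rewrite -natr1 mulrDr mulr1; move: IH; lra.
Qed.

End abscissa_le_supremum.

(** * Typical sequences *)

Section typical_sequences.
Context (R : realType) (B : finType) (p : B -> R).
Hypothesis p_ge0 : forall b, 0 <= p b.
Hypothesis p_sum1 : \sum_b p b = 1.

Definition product_weight (s : seq B) : R := \prod_(b <- s) p b.

Lemma product_weight_ge0 s : 0 <= product_weight s.
Proof. exact: prodr_ge0. Qed.

Lemma product_weight_rcons s b :
  product_weight (rcons s b) = product_weight s * p b.
Proof. by rewrite /product_weight -cats1 big_cat/= big_seq1. Qed.

Lemma product_weight_sum1 q : \sum_(t : q.-tuple B) product_weight t = 1.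
Proof.
elim: q => [|q IH].
  rewrite (bigD1 [tuple])//= big1 ?addr0 /product_weight ?big_nil// => t /negP[].
  by apply/eqP; exact: tuple0.
rewrite (sum_tuple_rcons _ product_weight) -IH; apply: eq_bigr => t _.
under eq_bigr do rewrite product_weight_rcons.
by rewrite -mulr_sumr p_sum1 mulr1.
Qed.

Lemma product_weight_variance (psi : B -> R) q : \sum_b p b * psi b = 0 ->
  \sum_(t : q.-tuple B) product_weight t * (\sum_(b <- t) psi b) ^+ 2 =
  q%:R * \sum_b p b * psi b ^+ 2.
Proof.
move=> psi0; elim: q => [|q IH].
  by rewrite big1 ?mul0r// => t _; rewrite tuple0 big_nil expr0n mulr0.
rewrite (sum_tuple_rcons _ (fun t => product_weight t * (\sum_(b <- t) psi b) ^+ 2)).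
rewrite -natr1 mulrDl mul1r -IH -[X in _ = _ + X]mul1r -(product_weight_sum1 q).
rewrite mulr_suml -big_split/=; apply: eq_bigr => t _.
set x := \sum_(b <- t) psi b.
have E b : product_weight (rcons t b) * (\sum_(b <- rcons t b) psi b) ^+ 2 =
    product_weight t * (x ^+ 2 * p b + (x *+ 2) * (p b * psi b) + p b * psi b ^+ 2).
  rewrite product_weight_rcons -cats1 big_cat/= big_seq1 -/x; ring.
under eq_bigr do rewrite E.
rewrite -mulr_sumr !big_split/= -!mulr_sumr p_sum1 psi0 mulr0 addr0 mulr1.
by rewrite mulrDr.
Qed.

Lemma chebyshev_words (psi : B -> R) q (e : R) : \sum_b p b * psi b = 0 ->
  0 < e -> (0 < q)%N ->
  \sum_(t : q.-tuple B | q%:R * e < `|\sum_(b <- t) psi b|) product_weight t <=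
  (\sum_b p b * psi b ^+ 2) / (q%:R * e ^+ 2).
Proof.
move=> psi0 e0 q0; have qR : 0 < q%:R :> R by rewrite ltr0n.
rewrite ler_pdivlMr ?mulr_gt0 ?exprn_gt0//.
rewrite -(ler_pM2l qR) -(product_weight_variance q psi0).
set M := (X in _ * (X * _) <= _).
have -> : q%:R * (M * (q%:R * e ^+ 2)) = (q%:R * e) ^+ 2 * M by ring.
rewrite {}/M.
rewrite mulr_sumr big_mkcond/=; apply: ler_sum => t _.
case: ifPn => [h|_]; last by rewrite mulr_ge0 ?product_weight_ge0 ?sqr_ge0.
rewrite mulrC ler_wpM2l ?product_weight_ge0// -[leRHS]real_normK ?num_real//.
by rewrite ler_sqr ?nnegrE// ?mulr_ge0 ?ltW.
Qed.

Lemma ln_product_weight s : 0 < product_weight s ->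
  ln (product_weight s) = \sum_(b <- s) ln (p b).
Proof.
elim: s => [|b s IH]; rewrite /product_weight ?big_nil ?ln1// !big_cons -/(product_weight s).
move=> W0; have pb : 0 < p b.
  by rewrite lt_neqAle p_ge0 andbT; apply: contraTneq W0 => <-; rewrite mul0r ltxx.
have Ws : 0 < product_weight s by move: W0; rewrite pmulr_rgt0.
by rewrite lnM ?posrE// IH.
Qed.

(** The law of large numbers for finitely many statistics [phi i], together
    with the count of the sequences that obey it: the statistic [- ln p] says
    that each of them has weight about [expR (- q * entropy p)]. *)
Lemma typical_sequences (I : finType) (phi : I -> B -> R) (e : R) : 0 < e ->
  exists q0, forall q, (q0 <= q)%N -> exists T : {set q.-tuple B},
    expR (q%:R * (entropy p - e)) <= #|T|%:R /\
    forall t, t \in T -> forall i,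
      `|\sum_(b <- t) phi i b - q%:R * \sum_b p b * phi i b| <= q%:R * e.
Proof.
move=> e0; have e2 : 0 < e / 2 by rewrite divr_gt0.
pose stat (o : option I) b : R := if o is Some i then phi i b else - ln (p b).
pose mean o := \sum_b p b * stat o b.
pose psi o b := stat o b - mean o.
have psi0 o : \sum_b p b * psi o b = 0.
  under eq_bigr do rewrite mulrBr.
  by rewrite sumrB -mulr_suml p_sum1 mul1r subrr.
pose V := \sum_o \sum_b p b * psi o b ^+ 2.
have V0 : 0 <= V by apply: sumr_ge0 => o _; apply: sumr_ge0 => b _; rewrite mulr_ge0 ?sqr_ge0.
(* Beyond the first term of [K] the good sequences have weight at least [1 / 2];
   beyond the second, this factor is absorbed by [expR (q * (e / 2))]. *)
pose K := V / (e / 2) ^+ 2 * 2 + ln 2 / (e / 2).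
exists (Num.truncn K).+1 => q qK.
have q0 : (0 < q)%N by exact: leq_trans qK.
have qR : 0 < q%:R :> R by rewrite ltr0n.
have Kq : K <= q%:R.
  by apply: le_trans (ltW (truncnS_gt _)) _; rewrite ler_nat.
have ln2 : 0 <= ln 2 :> R by rewrite ln_ge0// ler1n.
have K1 : V / (q%:R * (e / 2) ^+ 2) <= 1 / 2.
  have : V / (e / 2) ^+ 2 * 2 <= q%:R.
    by apply: le_trans Kq; rewrite lerDl divr_ge0// ltW.
  rewrite -[X in X <= q%:R]mulrA [_^-1 * 2]mulrC !mulrA ler_pdivrMr ?exprn_gt0//.
  move=> h; rewrite ler_pdivrMr ?mulr_gt0 ?exprn_gt0//; move: h; lra.
have K2 : ln 2 <= q%:R * (e / 2).
  rewrite -ler_pdivrMr//; apply: le_trans Kq; rewrite lerDr mulr_ge0//.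
  by rewrite divr_ge0 ?sqr_ge0.
pose good (t : q.-tuple B) := (0 < product_weight t) &&
  [forall o, `|\sum_(b <- t) psi o b| <= q%:R * (e / 2)].
have psiE o (t : q.-tuple B) : \sum_(b <- t) psi o b =
    \sum_(b <- t) stat o b - q%:R * mean o.
  rewrite sumrB; congr (_ - _).
  by rewrite big_const_seq count_predT size_tuple iter_addr_0 mulr_natl.
exists (finset good); split; last first.
  move=> t; rewrite inE => /andP[_ /forallP H] i.
  have := H (Some i); rewrite psiE => /le_trans; apply.
  by rewrite ler_wpM2l// ler_pdivrMr// ler_pMr// ler1n.
have mass : 1 / 2 <= \sum_(t : q.-tuple B | good t) product_weight t.
  have := product_weight_sum1 q; rewrite (bigID good)/= => E.
  suff : \sum_(t : q.-tuple B | ~~ good t) product_weight t <= 1 / 2 by move: E; lra.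
  apply: le_trans K1.
  apply: (@le_trans _ _ (\sum_o \sum_(t : q.-tuple B |
      q%:R * (e / 2) < `|\sum_(b <- t) psi o b|) product_weight t)).
    under [leRHS]eq_bigr do rewrite big_mkcond/=.
    rewrite exchange_big/= big_mkcond/=; apply: ler_sum => t _.
    case: ifPn => [|_]; last by apply: sumr_ge0 => o _; case: ifP => // _; exact: product_weight_ge0.
    rewrite negb_and => /orP[W0|nH].
      have -> : product_weight t = 0.
        by apply/eqP; rewrite eq_le product_weight_ge0 andbT leNgt.
      by rewrite big1// => o _; case: ifP.
    have [j ho] := forallPn nH; rewrite -ltNge in ho; rewrite (bigD1 j)//= ho lerDl.
    by apply: sumr_ge0 => o' _; case: ifP => // _; exact: product_weight_ge0.
  rewrite /V mulr_suml; apply: ler_sum => o _; exact: chebyshev_words.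
have bound t : good t -> product_weight t <= expR (- (q%:R * (entropy p - e / 2))).
  move=> /andP[W0 /forallP/(_ None)]; rewrite psiE ler_norml => /andP[h _].
  rewrite -[leLHS]lnK ?posrE// ler_expR ln_product_weight//.
  move: h; rewrite /stat sumrN.
  have -> : mean None = entropy p by apply: eq_bigr => b _; rewrite mulrN.
  rewrite mulrBr; lra.
have : 1 / 2 <= #|finset good|%:R * expR (- (q%:R * (entropy p - e / 2))).
  apply: le_trans mass _; rewrite mulr_natl -sumr_const.
  rewrite [leRHS](eq_bigl good) => [|t]; last by rewrite inE.
  by apply: ler_sum => t /bound.
rewrite expRN ler_pdivlMr ?expR_gt0// => /(le_trans _); apply.
rewrite -[1 / 2]mul1r; have -> : 1 * (1 / 2) = expR (- ln 2) :> R.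
  by rewrite expRN lnK ?posrE// !mul1r.
rewrite -expRD ler_expR; move: K2; lra.
Qed.

End typical_sequences.

(** * The supremum is at most the spectrum *)

Section weak_neighbourhoods.
Context (R : realType) (N : nat).
Local Notation A := 'I_N.+1.

Definition cyl_close m (e : R) (mu nu : probability (strings N) R) :=
  forall w : seq A, (size w <= m)%N -> `|cyl nu w - cyl mu w| <= e.

Lemma cyl_close_weaken m1 m2 (e1 e2 : R) mu nu : (m1 <= m2)%N -> e2 <= e1 ->
  cyl_close m2 e2 mu nu -> cyl_close m1 e1 mu nu.
Proof.
by move=> m12 e12 H w wm; apply: le_trans e12; apply: H; exact: leq_trans m12.
Qed.

(** The measures that agree with [mu] up to [1 / m.+1] on the words of length at
    most [m] form a filter that converges to [mu] by [cvg_weak]. *)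
Lemma nbhs_cyl_close (mu : probability (strings N) R)
    (V : set (probability (strings N) R)) :
  nbhs mu V -> exists m (e : R), 0 < e /\ forall nu, cyl_close m e mu nu -> V nu.
Proof.
move=> Vmu.
pose F := filter_from [set: nat] (fun m => [set nu | cyl_close m (m.+1%:R^-1) mu nu]).
have FF : Filter F.
  apply: filter_from_filter; first by exists 0%N.
  move=> i j _ _; exists (maxn i j) => // nu /= H.
  by split; apply: cyl_close_weaken H; rewrite ?leq_maxl ?leq_maxr// lef_pV2 ?posrE//
    ler_nat ltnS ?leq_maxl ?leq_maxr.
have /(_ _ Vmu) : (fun nu => nu) @ F --> mu.
  apply: cvg_weak => w; apply/cvgrPdist_le => e e0.
  exists (maxn (size w) (Num.truncn e^-1)) => // nu /= H.
  rewrite distrC; apply: le_trans (H w (leq_maxl _ _)) _.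
  rewrite invf_ple ?posrE ?ltr0n//; apply: le_trans (ltW (truncnS_gt _)) _.
  by rewrite ler_nat ltnS leq_maxr.
move=> [m _ Hm]; exists m, (m.+1%:R^-1); split; first by rewrite invr_gt0.
by move=> nu; exact: Hm.
Qed.

End weak_neighbourhoods.

Section block_words.
Context (R : realType) (N : nat) (mu : probability (strings N) R).
Hypothesis imu : shift_invariant mu.
Local Notation A := 'I_N.+1.
Local Notation S := (@string_shift N).

(** The occurrences of [w] that lie inside the block [b] of length [l]. In a
    concatenation of blocks, each block adds at most [size w] others, those that
    cross its end. *)
Definition inner_occurrences (l : nat) (w : seq A) (b : seq A) : R :=
  \sum_(a < l | (a + size w <= l)%N) (take (size w) (drop a b) == w)%:R.

Lemma occurrencesD m n (x : strings N) w :
  occurrences R (m + n) x w = occurrences R m x w + occurrences R n (iter m S x) w.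
Proof.
rewrite /occurrences big_split_ord/=; congr (_ + _); apply: eq_bigr => k _.
by rewrite -iterD addnC.
Qed.

Lemma occurrences_ge0 n (x : strings N) w : 0 <= occurrences R n x w.
Proof. exact: sumr_ge0. Qed.

Lemma occurrences_le n (x : strings N) w : occurrences R n x w <= n%:R.
Proof.
rewrite -[n in leRHS]card_ord -sumr_const; apply: ler_sum => k _.
by case: (_ == _).
Qed.

Lemma boundary_count l k :
  (\sum_(a < l | ~~ (a + k <= l)%N) 1 <= k)%N.
Proof.
rewrite -(big_mkord (fun a => ~~ (a + k <= l)%N) (fun=> 1%N)).
have [kl|lk] := leqP k l; last first.
  rewrite big_mkcond/=; apply: leq_trans (leq_sum _ (fun a _ => _ : _ <= 1)%N) _.
    by move=> a; case: ifP.
  by rewrite sum_nat_const_nat subn0 muln1 ltnW.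
rewrite (@big_cat_nat _ _ _ (l - k)) ?leq_subr//= big_nat_cond big1 ?add0n.
  rewrite big_mkcond/=; apply: leq_trans (leq_sum _ (fun a _ => _ : _ <= 1)%N) _.
    by move=> a; case: ifP.
  by rewrite sum_nat_const_nat muln1 subKn.
move=> a /andP[/andP[_ alk]]; rewrite -ltnNge => lak.
by move: alk; rewrite ltn_subRL addnC => /ltn_trans/(_ lak); rewrite ltnn.
Qed.

Lemma inner_occurrences_prefix l w (x : strings N) :
  0 <= occurrences R l x w - inner_occurrences l w (string_prefix l x) <= (size w)%:R.
Proof.
rewrite /occurrences (bigID (fun a : 'I_l => (a + size w <= l)%N))/=.
set X := (X in X + _ - _); set Y := (X in _ + X - _).
have -> : inner_occurrences l w (string_prefix l x) = X.
  apply: eq_bigr => a al; congr (nat_of_bool (_ == _))%:R.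
  rewrite prefix_iter_shift.
  have wla : (size w <= size (drop a (string_prefix l x)))%N.
    by rewrite size_drop size_prefix leq_subRL// ltnW.
  apply: (@eq_from_nth _ ord0).
    by rewrite size_takel// size_drop size_prefix addKn.
  move=> k; rewrite size_takel// => kw.
  rewrite nth_take// !nth_drop !nth_prefix ?ltn_add2l//.
  by apply: leq_trans al; rewrite ltn_add2l.
rewrite addrAC subrr add0r; apply/andP; split; first exact: sumr_ge0.
apply: le_trans (_ : (\sum_(a < l | ~~ (a + size w <= l)%N) 1)%:R <= _).
  by rewrite natr_sum; apply: ler_sum => a _; case: (_ == _).
by rewrite ler_nat boundary_count.
Qed.

Lemma occurrences_flatten l (bs : seq (seq A)) w (x : strings N) :
  (forall b, b \in bs -> size b = l) ->
  string_prefix (size bs * l) x = flatten bs ->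
  0 <= occurrences R (size bs * l) x w - \sum_(b <- bs) inner_occurrences l w b
    <= (size bs)%:R * (size w)%:R.
Proof.
elim: bs x => [|b bs IH] x Hl /= xbs.
  by rewrite mul0n /occurrences big_ord0 big_nil subrr mul0r lexx.
have bl : size b = l by apply: Hl; rewrite inE eqxx.
have xb : string_prefix l x = b.
  by rewrite -(take_prefix x (leq_addr (size bs * l) l)) -mulSn xbs take_size_cat.
have xbs' : string_prefix (size bs * l) (iter l S x) = flatten bs.
  by rewrite prefix_iter_shift -mulSn xbs drop_size_cat.
have Hl' c : c \in bs -> size c = l.
  by move=> cb; apply: Hl; rewrite inE cb orbT.
have := IH (iter l S x) Hl' xbs'.
have := inner_occurrences_prefix l w x.
rewrite xb mulSn occurrencesD big_cons -natr1 mulrDl mul1r.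
move=> /andP[h1 h2] /andP[h3 h4].
by apply/andP; split; lra.
Qed.

Lemma inner_occurrences_mean l w :
  \sum_(b : l.-tuple A) cyl mu b * inner_occurrences l w b =
  \sum_(a < l | (a + size w <= l)%N) cyl mu w.
Proof.
under eq_bigr do rewrite mulr_sumr.
rewrite exchange_big/=; apply: eq_bigr => a al.
have mp := @finite_measurable_prefix N l.
rewrite (eq_bigr (fun b : l.-tuple A => if take (size w) (drop a b) == w
    then law mu (@prefix_tuple N l) b else 0)); last first.
  by move=> b _; rewrite law_prefix; case: (_ == _); rewrite ?mulr1 ?mulr0.
rewrite -big_mkcond/= law_sum//.
pose wt := Tuple (introT eqP (erefl (size w))) : (size w).-tuple A.
have -> : cyl mu w = law mu (@prefix_tuple N (size w)) wt by rewrite law_prefix.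
rewrite -(law_shift a wt (@measurable_shift N) imu (@finite_measurable_prefix N _)).
congr (fine (mu _)); apply/seteqP.
have E x : take (size w) (drop a (string_prefix l x)) =
    string_prefix (size w) (iter a S x).
  rewrite prefix_iter_shift -(take_prefix x al) take_drop addnC.
  by rewrite addnC.
split=> x /=; rewrite E.
  by move=> /eqP xw; apply: val_inj => /=; rewrite xw.
by move=> /(congr1 val) /= ->; rewrite eqxx.
Qed.

Lemma inner_occurrences_mean_near l w :
  `|\sum_(b : l.-tuple A) cyl mu b * inner_occurrences l w b - l%:R * cyl mu w| <=
  (size w)%:R.
Proof.
rewrite inner_occurrences_mean.
have -> : l%:R * cyl mu w = \sum_(a < l) cyl mu w.
  by rewrite sumr_const card_ord mulr_natl.
rewrite [X in _ - X](bigID (fun a : 'I_l => (a + size w <= l)%N))/=.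
rewrite opprD addrA subrr sub0r normrN ger0_norm; last first.
  by apply: sumr_ge0 => *; exact: cyl_ge0.
apply: le_trans (_ : (\sum_(a < l | ~~ (a + size w <= l)%N) 1)%:R <= _).
  rewrite natr_sum; apply: ler_sum => a _.
  by rewrite -lee_fin -cylE probability_le1//; exact: measurable_cylinder.
by rewrite ler_nat boundary_count.
Qed.

Lemma flatten_inj l (s t : seq (seq A)) : size s = size t ->
  (forall b, b \in s -> size b = l) -> (forall b, b \in t -> size b = l) ->
  flatten s = flatten t -> s = t.
Proof.
elim: s t => [[]//|b s IH] [//|c t] /= [st] Hs Ht /eqP.
have bl : size b = l by apply: Hs; rewrite inE eqxx.
have cl : size c = l by apply: Ht; rewrite inE eqxx.
rewrite eqseq_cat ?bl ?cl// => /andP[/eqP -> /eqP /IH ->//].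
  by move=> d ds; apply: Hs; rewrite inE ds orbT.
by move=> d dt; apply: Ht; rewrite inE dt orbT.
Qed.

Definition concat l q (ts : q.-tuple (l.-tuple A)) : seq A :=
  flatten [seq tval b | b <- ts].

Lemma size_concat l q (ts : q.-tuple (l.-tuple A)) : size (concat ts) = (q * l)%N.
Proof.
rewrite /concat size_flatten /shape -map_comp.
rewrite (eq_map (g := fun=> l)); last by move=> b /=; exact: size_tuple.
rewrite -[in RHS](size_tuple ts); elim: (tval ts) => //= b s ->.
by rewrite mulSn.
Qed.

Lemma concat_inj l q : injective (@concat l q).
Proof.
move=> s t; rewrite /concat => st; apply: val_inj.
apply: (inj_map val_inj); apply: flatten_inj st.
- by rewrite !size_map !size_tuple.
- by move=> _ /mapP[b _ ->]; exact: size_tuple.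
- by move=> _ /mapP[b _ ->]; exact: size_tuple.
Qed.

(** Draw [q] blocks of length [l] independently with the law of [mu]. A typical
    sequence of blocks contains each block in the right proportion, so its
    concatenation imitates [mu], be it ergodic or not, up to the occurrences that
    cross the ends of blocks. The hypothesis on [l] makes these and the
    fluctuation negligible: in [(2 * m + 1)] one [m] counts the crossings, the
    other those that are missing from the mean of [inner_occurrences]. *)
Lemma exists_block_words m l (e eta : R) : 0 < e -> (0 < l)%N ->
  (2 * m + 1)%:R <= eta * l%:R ->
  exists q0, forall q, (q0 <= q)%N -> exists T : {set q.-tuple (l.-tuple A)},
    expR (q%:R * (block_entropy mu l - e)) <= #|T|%:R /\
    forall ts, ts \in T -> forall x, string_prefix (q * l) x = concat ts ->
      cyl_close m eta mu (empirical R (q * l) x).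
Proof.
move=> e0 l0 ml.
pose phi (i : 'I_m.+1 * m.-tuple A) (b : l.-tuple A) : R :=
  inner_occurrences l (take i.1 i.2) b.
have p0 (b : l.-tuple A) : 0 <= cyl mu b by exact: cyl_ge0.
have p1 : \sum_(b : l.-tuple A) cyl mu b = 1.
  rewrite -(law_sum1 mu (@finite_measurable_prefix N l)).
  by apply: eq_bigr => t _; rewrite law_prefix.
have e1 : 0 < Num.min e 1 by rewrite lt_min e0 ltr01.
have [q0 Hq] := typical_sequences p0 p1 phi e1.
exists (maxn 1 q0) => q; rewrite geq_max => /andP[q1 /Hq[T [cT HT]]].
exists T; split.
  apply: le_trans cT; rewrite ler_expR ler_wpM2l// lerD2l lerN2.
  by rewrite ge_min lexx.
move=> ts /HT Hts x xts w wm.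
have ql0 : (0 < q * l)%N by rewrite muln_gt0 q1.
have qR : 0 < q%:R :> R by rewrite ltr0n.
have lR : 0 < l%:R :> R by rewrite ltr0n.
have := Hts (inord (size w), prefix_tuple m (pad w)).
rewrite /phi /= inordK ?ltnS// take_prefix// prefix_pad => h1.
have h2 := inner_occurrences_mean_near l w.
have sq : size [seq tval b | b <- ts] = q by rewrite size_map size_tuple.
have := @occurrences_flatten l [seq tval b | b <- ts] w x.
rewrite sq big_map => /(_ _ xts)/andP[|h3 h4].
  by move=> _ /mapP[b _ ->]; exact: size_tuple.
rewrite cyl_empirical// natrM.
have wm' : (size w)%:R <= m%:R :> R by rewrite ler_nat.
have h5 : `|occurrences R (q * l) x w - q%:R * l%:R * cyl mu w| <=
    q%:R * (2 * m + 1)%:R.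
  have h6 : q%:R * (size w)%:R <= q%:R * m%:R :> R by rewrite ler_pM2l.
  have h7 : q%:R * Num.min e 1 <= q%:R :> R.
    by rewrite ler_piMr// ge_min lexx orbT.
  have := ler_wpM2l (ltW qR) h2; rewrite -[X in X * `|_|]gtr0_norm// -normrM mulrBr.
  move: h1 h3 h4 h6 h7.
  rewrite natrD natrM !ler_norml => /andP[a1 a2] a3 a4 a5 a6 /andP[a7 a8].
  by apply/andP; split; lra.
have -> : occurrences R (q * l) x w / (q%:R * l%:R) - cyl mu w =
    (occurrences R (q * l) x w - q%:R * l%:R * cyl mu w) / (q%:R * l%:R).
  by field; rewrite !gt_eqF.
rewrite normrM (gtr0_norm (x := _^-1)) ?invr_gt0 ?mulr_gt0//.
rewrite ler_pdivrMr ?mulr_gt0//; apply: le_trans h5 _.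
by rewrite mulrCA ler_pM2l.
Qed.

(** The empirical measure of the longer word is an average over [n'] times, of
    which only the last [n' - n] are new. *)
Lemma cyl_close_extend m (eta : R) n n' x : (0 < n)%N -> (n <= n')%N ->
  (n' - n)%:R <= eta * n%:R -> cyl_close m eta mu (empirical R n x) ->
  cyl_close m (2 * eta) mu (empirical R n' x).
Proof.
move=> n0 nn' dn H w /H; have n0' : (0 < n')%N by exact: leq_trans nn'.
rewrite !cyl_empirical//.
have nR : 0 < n%:R :> R by rewrite ltr0n.
have nR' : 0 < n'%:R :> R by rewrite ltr0n.
have E k : 0 < k%:R :> R -> occurrences R k x w / k%:R - cyl mu w =
    (occurrences R k x w - k%:R * cyl mu w) / k%:R.
  by move=> k0; field; rewrite gt_eqF.
rewrite !E// !normrM !(gtr0_norm (x := _^-1)) ?invr_gt0// !ler_pdivrMr//.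
have := occurrencesD n (n' - n) x w; rewrite subnKC// => ->.
have := occurrences_ge0 (n' - n) (iter n S x) w.
have := occurrences_le (n' - n) (iter n S x) w.
set o1 := occurrences _ _ _ _; set o2 := occurrences _ _ _ _ => b1 b2.
have n'E : n'%:R = n%:R + (n' - n)%:R :> R by rewrite -natrD subnKC.
have p1 : 0 <= cyl mu w <= 1.
  rewrite cyl_ge0 -lee_fin -cylE probability_le1//; exact: measurable_cylinder.
have p2 : 0 <= (n' - n)%:R * cyl mu w <= (n' - n)%:R.
  by case/andP: p1 => p3 p4; rewrite mulr_ge0//= ler_piMr.
have eta0 : 0 <= eta * n%:R by apply: le_trans dn.
have eta1 : eta * n%:R <= eta * n'%:R.
  by rewrite ler_wpM2l ?ler_nat//; move: eta0; rewrite pmulr_lge0.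
rewrite !ler_norml => /andP[a1 a2]; case/andP: p2 => p3 p4.
have E2 : n'%:R * cyl mu w = n%:R * cyl mu w + (n' - n)%:R * cyl mu w.
  by rewrite n'E mulrDl.
by rewrite E2; apply/andP; split; lra.
Qed.

End block_words.

Lemma card_le_counting (R : realType) (I : finType) (T : choiceType)
    (D : {set I}) (f : I -> T) (B : set T) :
  {in D &, injective f} -> (forall i, i \in D -> B (f i)) ->
  ((#|D|%:R)%:E <= (counting B : \bar R))%E.
Proof.
move=> fi fB; rewrite /counting; case: asboolP => [fin|_]; last exact: leey.
rewrite lee_fin ler_nat cardE -(size_map f).
apply: uniq_leq_size => [|x /mapP[i iD ->]].
  rewrite map_inj_in_uniq ?enum_uniq// => i j.
  by rewrite !mem_enum; exact: fi.
by rewrite in_fset_set// inE; apply: fB; rewrite -mem_enum.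
Qed.

Section supremum_le_spectrum.
Context (R : realType) (N : nat) (X : metricType R).
Context (U : probability (strings N) R -> X) (L : strings N -> R) (C : set X).
Local Notation A := 'I_N.+1.
Local Notation S := (@string_shift N).
Hypothesis U_cont : continuous U.
Hypothesis L_cont : continuous L.
Hypothesis L_neg : bounded_negative L.
Hypothesis L_dist : bounded_distortion L.
Context (mu : probability (strings N) R).
Hypothesis imu : shift_invariant mu.
Hypothesis CUmu : C (U mu).

Lemma cball_nbhs (r : R) : 0 < r -> nbhs (U mu) (cball C r).
Proof.
move=> r0; apply/nbhs_ballP; exists r => // x.
rewrite ballEmdist /= => xr; rewrite /cball /=.
apply: le_trans (_ : (mdist x (U mu))%:E <= _)%E.
  by apply: ereal_inf_lbound; exists (U mu).
by rewrite lee_fin metric_sym ltW.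
Qed.

(** Extend a word by the letters of [x] until its contraction ratio first drops
    to [dl]. *)
Lemma exists_stopping (cmin cmax : R) n dl (x : strings N) :
  cmax < 0 -> (forall i, cmin <= L i <= cmax) -> 0 < dl ->
  ln dl < ln_s L (string_prefix n x) ->
  exists n', [/\ (n < n')%N, s_approx L (string_prefix n' x) dl &
    ln dl < ln_s L (string_prefix n x) + (n'.-1 - n)%:R * cmax].
Proof.
move=> cmax0 Lb dl0 nd.
pose P k := ln_s L (string_prefix k x) <= ln dl.
have exP : exists k, P k.
  pose k := (Num.truncn (ln dl / cmax)).+1; exists k.
  apply: (ln_s_le Lb) => y _; rewrite size_prefix.
  apply: le_trans (birkhoff_le Lb k y) _.
  by rewrite -ler_ndivrMr// ltW// truncnS_gt.
case: (ex_minnP exP) => n' Pn' n'min.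
have decr i j : (i <= j)%N -> ln_s L (string_prefix j x) <=
    ln_s L (string_prefix i x) + (j - i)%:R * cmax.
  move=> ij; have := @ln_s_take _ _ _ _ _ Lb i (string_prefix j x).
  by rewrite size_prefix take_prefix//; apply.
have nn' : (n < n')%N.
  rewrite ltnNge; apply/negP => n'n; have := lt_le_trans nd (decr _ _ n'n).
  rewrite ltNge => /negP; apply; apply: le_trans Pn'.
  by rewrite gerDl mulr_ge0_le0// ltW.
have n'0 : (0 < n')%N by exact: leq_ltn_trans nn'.
have lt1 : ln dl < ln_s L (string_prefix n'.-1 x).
  rewrite ltNge; apply/negP => /n'min; rewrite leqNgt => /negP; apply.
  by rewrite prednK.
exists n'; split=> //.
  apply/(s_approxP Lb _ dl0); rewrite -/(P n') Pn' /= size_prefix take_prefix ?leq_pred//.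
by apply: lt_le_trans lt1 (decr _ _ _); rewrite -ltnS prednK.
Qed.

Let a : R := - \int[mu]_x L x.

Lemma Rintegral_bounds (cmin cmax : R) : (forall i, cmin <= L i <= cmax) ->
  cmin <= \int[mu]_x L x <= cmax.
Proof.
move=> Lb; have iL := integrable_continuous mu L_cont.
have ic (k : R) : mu.-integrable setT (EFin \o cst k).
  exact: finite_measure_integrable_cst.
have cE (k : R) : k = \int[mu]_x cst k x.
  rewrite Rintegral_cst// -[LHS]mulr1; congr (_ * _).
  exact/esym/(congr1 fine (probability_setT mu)).
rewrite [X in X <= _ <= _]cE [X in _ <= _ <= X]cE.
by apply/andP; split; apply: le_Rintegral => // x _; have /andP[] := Lb x.
Qed.

(** Write [h] for the entropy and [a] for minus the integral of [L]. Given [dl],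
    take [n], a multiple of [l], slightly below [- ln dl / a]. There are about
    [expR (n * h)] words of length [n] that imitate [mu], and each of them has a
    contraction ratio slightly above [dl]. Prolong each until the ratio drops to
    [dl]. This takes few letters, so that the empirical measures of the longer
    words remain near [mu], and their images under [U] near [U mu], a point of
    [C]. This gives about [expR (- ln dl * h / a)] words counted at [dl]. *)
Lemma le_coarse_spectrum_at (r y : R) : 0 < r -> y * a < rate (block_entropy mu) ->
  (y%:E <= coarse_spectrum_at U L C r)%E.
Proof.
move=> r0; set h := rate _ => ya.
have [cmin [cmax [_ cmax0 Lb]]] := L_neg; have [c c1 Ld] := L_dist.
have a0 : 0 < a.
  have /andP[_] := Rintegral_bounds Lb; rewrite /a => h1.
  by rewrite oppr_gt0 (le_lt_trans h1).
have [m1 [eta1 [eta10 HU]]] : exists m (e : R), 0 < e /\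
    forall nu, cyl_close m e mu nu -> cball C r (U nu).
  by apply: nbhs_cyl_close; apply: U_cont; exact: cball_nbhs.
pose gam := - cmax; have gam0 : 0 < gam by rewrite oppr_gt0.
(* The first bound keeps [y * (a + e)] below [h - e], the second one keeps the
   number of appended letters below [eta1 / 2 * n]. *)
pose e := Num.min ((h - y * a) / (2 * (`|y| + 1))) (eta1 * gam / 16).
have y1 : 0 < 2 * (`|y| + 1) by rewrite mulr_gt0// ltr_wpDl.
have e0 : 0 < e.
  by rewrite !lt_min !divr_gt0 ?mulr_gt0 ?subr_gt0.
have e_y : y * (a + e) < h - e.
  have : e <= (h - y * a) / (2 * (`|y| + 1)) by rewrite ge_min lexx.
  rewrite ler_pdivlMr// => h1.
  have h2 : y * e <= `|y| * e by rewrite ler_wpM2r ?ler_norm// ltW.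
  have h3 : 0 <= `|y| * e by rewrite mulr_ge0// ltW.
  move: h1 h2 h3 e0; lra.
have e_eta : e <= eta1 * gam / 16 by rewrite ge_min lexx orbT.
have [m2 [eta2 [eta20 HL]]] : exists m (e2 : R), 0 < e2 /\
    forall nu, cyl_close m e2 mu nu -> `|\int[mu]_x L x - \int[nu]_x L x| < e.
  apply: nbhs_cyl_close.
  by move/cvgrPdist_lt : (@continuous_Rintegral R N L L_cont mu); apply.
pose m := maxn m1 m2; pose eta := Num.min (eta1 / 2) eta2.
have eta0 : 0 < eta by rewrite lt_min divr_gt0.
pose l := (Num.truncn ((2 * m + 1)%:R / eta)).+1.
have ml : (2 * m + 1)%:R <= eta * l%:R.
  by rewrite mulrC -ler_pdivrMr// ltW// truncnS_gt.
have l0 : (0 < l)%N by [].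
have lR : 0 < l%:R :> R by rewrite ltr0n.
have [q0 Hq0] := exists_block_words imu e0 l0 ml.
have ae0 : 0 < a + e by rewrite addr_gt0.
pose g := h - e - y * (a + e).
have g0 : 0 < g by rewrite subr_gt0.
(* Beyond [K1] the rounding of [n] to a multiple of [l] appends few letters;
   beyond [K2] it does not spoil the growth rate [y]. *)
pose K1 := (1 + l%:R * (a + e) / gam) / (eta1 * (3 / 8)).
pose K2 := `|y| * (l%:R * (a + e)) / g.
have K10 : 0 <= K1.
  rewrite divr_ge0//; last by rewrite mulr_ge0// ltW.
  by rewrite addr_ge0// divr_ge0// ?mulr_ge0// ltW.
have K20 : 0 <= K2 by rewrite divr_ge0// ?mulr_ge0// ltW.
pose K := q0%:R * l%:R + l%:R + K1 + K2.
pose D0 := (K + l%:R) * (a + e).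
rewrite /coarse_spectrum_at limf_einfE.
set F := fun dl : R => _.
suff: (y%:E <= ereal_inf [set F dl | dl in [set dl : R | (0 < dl < expR (- D0))%R]])%E.
  move/le_trans; apply; apply: ereal_sup_ubound.
  exists [set dl : R | 0 < dl < expR (- D0)] => //.
  near=> dl; apply/andP; split; near: dl; first exact: nbhs_right_gt.
  by apply: nbhs_right_lt; exact: expR_gt0.
apply: le_ereal_inf_tmp => _ [dl /= /andP[dl0 dlD] <-].
pose D := - ln dl.
have DD : D0 < D.
  by rewrite ltrNr -[X in _ < X]expRK ltr_ln ?posrE ?expR_gt0.
have D00 : 0 <= D0.
  by rewrite /D0 mulr_ge0 ?(ltW ae0)// /K !addr_ge0// mulr_ge0.
have Dgt0 : 0 < D by exact: le_lt_trans DD.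
pose q := Num.truncn (D / (l%:R * (a + e))); pose n := (q * l)%N.
have lae : 0 < l%:R * (a + e) by rewrite mulr_gt0.
have nE : n%:R = q%:R * l%:R :> R by rewrite natrM.
have nD : n%:R * (a + e) <= D.
  have : q%:R <= D / (l%:R * (a + e)) by rewrite truncn_le// divr_ge0 ?ltW.
  by rewrite ler_pdivlMr// nE mulrA.
have Dn : D < (n%:R + l%:R) * (a + e).
  have := truncnS_gt (D / (l%:R * (a + e))); rewrite -/q ltr_pdivrMr//.
  by rewrite -natr1 nE mulrDl mul1r mulrA -mulrDl.
have nK : K <= n%:R.
  have := lt_trans DD Dn; rewrite ltr_pM2r// => /ltW.
  by rewrite lerD2r.
have [nl nq nK1 nK2] : [/\ l%:R <= n%:R :> R, q0%:R * l%:R <= n%:R :> R,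
    K1 <= n%:R & K2 <= n%:R].
  have q0l : 0 <= q0%:R * l%:R :> R by rewrite mulr_ge0.
  by move: nK q0l K10 K20 lR; rewrite /K => *; split; lra.
have n0 : (0 < n)%N by rewrite -(ltr_nat R) (lt_le_trans lR).
have nR : 0 < n%:R :> R by rewrite ltr0n.
have qq0 : (q0 <= q)%N.
  by move: nq; rewrite nE ler_pM2r// ler_nat.
have [T [cT HT]] := Hq0 q qq0.
have close ts : ts \in T -> forall x, string_prefix n x = concat ts ->
    cyl_close m eta mu (empirical R n x) by exact: HT.
have birk ts x : ts \in T -> string_prefix n x = concat ts ->
    - (a + e) * n%:R < birkhoff L n x < - (a - e) * n%:R.
  move=> tsT xts; have : cyl_close m2 eta2 mu (empirical R n x).
    by apply: cyl_close_weaken (close _ tsT _ xts);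
      [exact: leq_maxr|rewrite ge_min lexx orbT].
  move/HL; rewrite Rintegral_empirical// ltr_norml => /andP[b1 b2].
  have -> : birkhoff L n x = birkhoff L n x / n%:R * n%:R by rewrite divfK// gt_eqF.
  by rewrite !ltr_pM2r// /a; apply/andP; split; lra.
have pre (ts : q.-tuple (l.-tuple A)) : string_prefix n (pad (concat ts)) = concat ts.
  by rewrite -[RHS]prefix_pad size_concat.
have cyl_pre (ts : q.-tuple (l.-tuple A)) x : cylinder (concat ts) x <-> string_prefix n x = concat ts.
  by rewrite /cylinder /= size_concat.
have /choice[stop Hstop] : forall ts : q.-tuple (l.-tuple A), exists n', ts \in T ->
    [/\ (n < n')%N, s_approx L (string_prefix n' (pad (concat ts))) dl &
    ln dl < ln_s L (concat ts) + (n'.-1 - n)%:R * cmax].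
  move=> ts; have [tsT|ntsT] := boolP (ts \in T); last by exists 0%N.
  have := @exists_stopping cmin cmax n dl (pad (concat ts)) cmax0 Lb dl0.
  rewrite pre => /(_ _)[|n' Hn']; last by exists n'.
  have := ln_s_ge Lb (cylinder_pad (concat ts)); rewrite size_concat -/n.
  have /andP[b1 _] := birk _ _ tsT (pre ts).
  move=> h1; apply: lt_le_trans h1; apply: le_lt_trans b1.
  by move: nD; rewrite /D; lra.
pose f ts := string_prefix (stop ts) (pad (concat ts)).
have count : ((#|T|%:R)%:E <= (counting (coarse_strings U L C r dl) : \bar R))%E.
  apply: (@card_le_counting _ _ _ T f) => [s t sT tT /(congr1 (take n))|ts tsT].
    have [ns _ _] := Hstop _ sT; have [nt _ _] := Hstop _ tT.
    by rewrite /f !take_prefix ?(ltnW ns) ?(ltnW nt)// !pre => /concat_inj.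
  have [nn' sa lnd] := Hstop _ tsT; split => //.
    by move/(congr1 size); rewrite size_prefix => n'0; rewrite n'0 in nn'.
  move=> _ [x fx <-]; rewrite size_prefix; apply: HU.
  have xts : string_prefix n x = concat ts.
    have := (cylinder_prefix _ _ _).1 fx; move/(prefix_leq (ltnW nn')) => ->.
    exact: pre.
  have le_s : ln_s L (concat ts) <= - (a - e) * n%:R.
    apply: (ln_s_le Lb) => z /cyl_pre zts; rewrite size_concat -/n.
    by have /andP[_ /ltW] := birk _ _ tsT zts.
  have ext : (stop ts - n)%:R <= eta1 / 2 * n%:R.
    have -> : (stop ts - n)%:R = (stop ts).-1%:R - n%:R + 1 :> R.
      rewrite natrB ?(ltnW nn')// -{1}(prednK (leq_ltn_trans (leq0n n) nn')) -natr1.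
      by rewrite addrAC.
    have n1 : (n <= (stop ts).-1)%N by rewrite -ltnS prednK// (leq_ltn_trans _ nn').
    move: lnd; rewrite natrB//; set z := (stop ts).-1%:R - n%:R => lnd.
    have z1 : z * gam < 2 * e * n%:R + l%:R * (a + e).
      by move: lnd le_s Dn; rewrite /D /gam; lra.
    have z2 : 2 * e * n%:R <= eta1 / 8 * n%:R * gam.
      have := ler_wpM2r (ltW nR) e_eta; lra.
    have z3 : (1 + l%:R * (a + e) / gam) <= n%:R * (eta1 * (3 / 8)).
      by move: nK1; rewrite ler_pdivrMr// mulr_gt0.
    have z4 : z < eta1 / 8 * n%:R + l%:R * (a + e) / gam.
      have w : l%:R * (a + e) / gam * gam = l%:R * (a + e) by rewrite divfK// gt_eqF.
      rewrite -(ltr_pM2r gam0) [X in _ < X]mulrDl w.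
      exact: lt_le_trans z1 (lerD z2 (lexx _)).
    by move: z3 z4; lra.
  have := cyl_close_extend n0 (ltnW nn') ext (m := m1) (mu := mu) (x := x).
  have -> : 2 * (eta1 / 2) = eta1 by field.
  apply; apply: cyl_close_weaken (close _ tsT _ xts); first exact: leq_maxl.
  by rewrite ge_min lexx.
rewrite /F -/D inver gt_eqF// lee_pdivlMr// -EFinM.
have T0 : 0 < #|T|%:R :> R by apply: lt_le_trans cT; exact: expR_gt0.
apply: (@le_trans _ _ (lne (#|T|%:R)%:E)); last first.
  rewrite lee_lne// in_itv/= leey andbT; first by rewrite lee_fin ltW.
  by apply: le_trans count; rewrite lee_fin ltW.
rewrite lne_EFin// lee_fin -/D.
apply: (@le_trans _ _ (q%:R * (block_entropy mu l - e))); last first.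
  by rewrite -[leLHS]expRK ler_ln ?posrE ?expR_gt0.
have Hl : h * l%:R <= block_entropy mu l.
  rewrite -ler_pdivlMr//; apply: rate_le => // k; exact: block_entropy_ge0.
have h1 : n%:R * (h - e) <= q%:R * (block_entropy mu l - e).
  rewrite nE -mulrA ler_wpM2l// mulrBr [l%:R * h]mulrC lerB//.
  by rewrite ler_peMl ?(ltW e0)// ler1n.
apply: le_trans h1.
have h2 : `|y| * (l%:R * (a + e)) <= n%:R * g by move: nK2; rewrite ler_pdivrMr.
have h3 : y * (D - n%:R * (a + e)) <= `|y| * (l%:R * (a + e)).
  apply: le_trans (ler_norm _) _; rewrite normrM ler_wpM2l// ger0_norm ?subr_ge0//.
  by move: Dn; lra.
by move: h2 h3; rewrite /g; lra.
Unshelve. all: by end_near. Qed.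

End supremum_le_spectrum.

(** * The variational formula *)

Lemma lte_exists_real (R : realType) (x y : \bar R) : (x < y)%E ->
  exists t : R, (x < t%:E)%E /\ (t%:E < y)%E.
Proof.
case: x y => [x| |] [y| |] //.
- rewrite lte_fin => xy; exists ((x + y) / 2); rewrite !lte_fin.
  by split; rewrite midf_lt.
- by move=> _; exists (x + 1); rewrite lte_fin ltrDl ltry.
- by move=> _; exists (y - 1); rewrite ltNyr lte_fin gtrBl.
- by move=> _; exists 0; rewrite ltNyr ltry.
Qed.

Section variational.
Context (R : realType) (N : nat) (X : metricType R).
Context (U : probability (strings N) R -> X) (L : strings N -> R) (C : set X).
Hypothesis U_cont : continuous U.
Hypothesis L_cont : continuous L.
Hypothesis L_neg : bounded_negative L.
Hypothesis L_dist : bounded_distortion L.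
Hypothesis C_closed : closed C.

Definition invariant_ratios : set (\bar R) :=
  [set (- (ks_entropy mu (@string_shift N) / \int[mu]_x (L x)%:E))%E
  | mu in [set mu : probability (strings N) R | shift_invariant mu /\ C (U mu)]].

Lemma ratioE (mu : probability (strings N) R) : shift_invariant mu ->
  (- (ks_entropy mu (@string_shift N) / \int[mu]_x (L x)%:E))%E =
  (rate (block_entropy mu) / - \int[mu]_x L x)%:E.
Proof.
move=> imu; have [cmin [cmax [_ cmax0 Lb]]] := L_neg.
have /andP[_ Ic] := Rintegral_bounds L_cont mu Lb.
rewrite ks_entropyE//.
have -> : (\int[mu]_x (L x)%:E = (\int[mu]_x L x)%:E)%E.
  by rewrite /Rintegral fineK//; exact: integrable_fin_num (integrable_continuous mu L_cont).
by rewrite inver lt_eqF ?(le_lt_trans Ic)// -EFinM -EFinN invrN mulrN.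
Qed.

(** For [e > 0] the real [y] equal to the ratio minus [e] satisfies the strict
    inequality of [le_coarse_spectrum_at]. *)
Lemma sup_ratios_le_coarse_spectrum_at r : 0 < r ->
  (ereal_sup invariant_ratios <= coarse_spectrum_at U L C r)%E.
Proof.
move=> r0; apply: ge_ereal_sup => _ [mu [imu CUmu] <-]; rewrite ratioE//.
have [cmin [cmax [_ cmax0 Lb]]] := L_neg.
have /andP[_ Ic] := Rintegral_bounds L_cont mu Lb.
have a0 : 0 < - \int[mu]_x L x by rewrite oppr_gt0 (le_lt_trans Ic).
apply/lee_subgt0Pr => e e0; rewrite -EFinB.
apply: (le_coarse_spectrum_at U_cont L_cont L_neg L_dist imu CUmu) => //.
by rewrite -ltr_pdivlMr// ltrBlDr ltrDl.
Qed.

(** A real [t] strictly between the two sides would be less than every abscissa,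
    so that all the series diverge at [t]; the invariant measure that
    [exists_invariant_measure] provides has ratio at least [t]. *)
Lemma inf_zeta_abscissa_le_sup_ratios :
  (ereal_inf [set zeta_abscissa U L (cball C r) | r in [set` `]0, 1[%R]] <=
   ereal_sup invariant_ratios)%E.
Proof.
rewrite leNgt; apply/negP => /lte_exists_real[t [St tI]].
have [cmin [cmax [_ cmax0 Lb]]] := L_neg.
have [r r0|mu [imu CUmu hmu]] := exists_invariant_measure U_cont L_cont L_neg
    L_dist C_closed (t := t).
  move=> sr; move: tI; apply/negP; rewrite -leNgt.
  pose r1 := Num.min r (1 / 2).
  apply: (@le_trans _ _ (zeta_abscissa U L (cball C r1))).
    apply: ereal_inf_lbound; exists r1 => //=.
    by rewrite in_itv/= lt_min r0 gt_min; apply/andP; split; [|apply/orP; right]; lra.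
  apply: ereal_inf_lbound; exists t => //.
  apply: summable_subset sr => w [w0 wU]; split=> // z /wU.
  by apply: cball_subset; rewrite ge_min lexx.
have /andP[_ Ic] := Rintegral_bounds L_cont mu Lb.
move: St; apply/negP; rewrite -leNgt.
apply: le_trans (ereal_sup_ubound (ex_intro2 _ _ mu (conj imu CUmu) erefl)).
rewrite ratioE// lee_fin ler_pdivlMr; last by rewrite oppr_gt0 (le_lt_trans Ic).
by rewrite mulrN lerNl -subr_ge0 opprK addrC.
Qed.

(** The abscissa is monotone in [r], so its limit is its infimum. *)
Lemma cvg_zeta_abscissa :
  zeta_abscissa U L (cball C r) @[r --> 0^'+] --> ereal_sup invariant_ratios.
Proof.
have sr r : 0 < r -> (ereal_sup invariant_ratios <= zeta_abscissa U L (cball C r))%E.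
  move=> r0; apply: le_trans (sup_ratios_le_coarse_spectrum_at r0) _.
  exact: coarse_spectrum_at_le_zeta_abscissa.
have -> : ereal_sup invariant_ratios =
    ereal_inf [set zeta_abscissa U L (cball C r) | r in [set` `]0, 1[%R]].
  apply/eqP; rewrite eq_le inf_zeta_abscissa_le_sup_ratios andbT.
  by apply: le_ereal_inf_tmp => _ [r /= /itvP r01 <-]; apply: sr; rewrite r01.
apply: (@nondecreasing_at_right_cvge _ _ 0 (BLeft 1)) => //.
  by rewrite bnd_simp.
move=> r1 r2 _ _ r12; apply: ereal_inf_le_tmp => _ [t st <-].
exists t => //; apply: summable_subset st => w [w0 wU]; split=> // z /wU.
exact: cball_subset.
Qed.

(** The spectrum lies between the supremum and the abscissa. *)
Lemma cvg_coarse_spectrum_at :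
  coarse_spectrum_at U L C r @[r --> 0^'+] --> ereal_sup invariant_ratios.
Proof.
apply: (@squeeze_cvge _ _ _ _ (fun=> ereal_sup invariant_ratios) _
  (fun r => zeta_abscissa U L (cball C r))); last 2 first.
- exact: cvg_cst.
- exact: cvg_zeta_abscissa.
near=> r; have r0 : 0 < r by near: r; exact: nbhs_right_gt.
by rewrite sup_ratios_le_coarse_spectrum_at//= coarse_spectrum_at_le_zeta_abscissa.
Unshelve. all: by end_near. Qed.

End variational.

Theorem theorem2p1 (R : realType) (N : nat) (X : metricType R)
    (U : probability (strings N) R -> X) (L : strings N -> R) (C : set X)
    (U_cont : continuous U)
    (L_cont : continuous L)
    (L_neg : bounded_negative L)
    (L_dist : bounded_distortion L)
    (C_closed : closed C) :
  (zeta_abscissa U L (cball C r) @[r --> 0^'+] --> coarse_spectrum U L C) /\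
  (zeta_abscissa U L (cball C r) @[r --> 0^'+] -->
    ereal_sup [set (- (ks_entropy mu (@string_shift N) / \int[mu]_x (L x)%:E))%E
              | mu in [set mu : probability (strings N) R |
                       shift_invariant mu /\ C (U mu)]]).
Proof.
have sup_cvg := cvg_zeta_abscissa U_cont L_cont L_neg L_dist C_closed.
split; last exact: sup_cvg.
rewrite /coarse_spectrum (cvg_lim _ (cvg_coarse_spectrum_at _ _ _ _ _))//.
Qed.
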